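(* Let $P$ be a finite poset, $n$ a natural number, and $\mathcal{J}$ a poset ideal in $\mathrm{Hom}(P,[n])$. The canonical module $\omega_{\Bbbk[\Delta(\mathcal{J})]}$ is (isomorphic, as a multigraded $\Bbbk[x_{P\times[n]}]$-module, to) the Alexander dual module of $L(\mathcal{J}|\mathcal{B})$.
   Context: $\Bbbk$ is a field, $[n]=\{1<2<\dots<n\}$, $S=\Bbbk[x_{P\times[n]}]$ is the polynomial ring with variables $x_{p,i}$, graded by $\mathbb{N}^{P\times[n]}$. $\mathrm{Hom}(P,[n])$ is the set of isotone (order-preserving) maps $P\to[n]$, a poset under the pointwise order. A poset ideal is a down-closed subset; $\mathcal{J}^c$ is the complement of $\mathcal{J}$ in $\mathrm{Hom}(P,[n])$. Put $m_{\Gamma\phi}=\prod_{p\in P}x_{p,\phi(p)}$. $L(\mathcal{J})$ (resp. $L(\mathcal{J}^c)$) is the ideal generated by all $m_{\Gamma\phi}$ with $\phi\in\mathcal{J}$ (resp. $\phi\in\mathcal{J}^c$). $B(P,n)$ is the ideal generated by the monomials $x_{p,i}x_{q,j}$ with $p<q$ and $i>j$, and $B(\mathcal{J})=L(\mathcal{J}^c)+B(P,n)$. $L(\mathcal{J}|\mathcal{B})$ is the image of the composition $L(\mathcal{J})\to S\to S/B(\mathcal{J})$ of the natural maps. The Alexander dual ideal $I^A$ of a squarefree monomial ideal $I$ is the ideal spanned by all monomials which have a non-trivial common divisor with every monomial in $I$. $\Delta(\mathcal{J})$ is the simplicial complex on $P\times[n]$ with Stanley–Reisner ideal $L(\mathcal{J})^A$;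 it is Cohen–Macaulay of codimension $|P|$, and the canonical module of its Stanley–Reisner ring is $\omega_{\Bbbk[\Delta(\mathcal{J})]}=\mathrm{Ext}^{|P|}_S(\Bbbk[\Delta(\mathcal{J})],S(-\mathbf 1))$, with $\mathbf 1$ the all-ones multidegree. A finitely generated $\mathbb{N}^{P\times[n]}$-graded $S$-module $M$ is squarefree if the multiplication $x_i:M_{\mathbf b}\to M_{\mathbf b+\epsilon_i}$ is an isomorphism whenever $b_i\ge1$ ($\epsilon_i$ the unit vectors). The Alexander dual module $M^*$ of a squarefree module $M$ is the squarefree module with $(M^* )_{\mathbf b}=\mathrm{Hom}_\Bbbk(M_{\mathbf 1-\mathbf b},\Bbbk)$ for every $0/1$-vector $\mathbf b$, where for $b_i=0$ the multiplication $x_i:(M^* )_{\mathbf b}\to(M^* )_{\mathbf b+\epsilon_i}$ is the dual of $x_i:M_{\mathbf 1-\mathbf b-\epsilon_i}\to M_{\mathbf 1-\mathbf b}$. *)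

(* Defs.v *)
From HB Require Import structures.
From mathcomp Require Import all_boot all_order all_algebra.
From mathcomp Require Import boolp mpoly.

Set Implicit Arguments.
Unset Strict Implicit.
Unset Printing Implicit Defensive.

Import Order.TTheory GRing.Theory.
Local Open Scope ring_scope.
Local Open Scope quotient_scope.

Section Modules.
Variable (R : comNzRingType).
Implicit Types M N : lmodType R.

Definition span M (G : M -> Prop) : {pred M} := fun x =>
  `[< exists s : seq (R * M),
        (forall z, z \in s -> G z.2) /\ x = \sum_(z <- s) z.1 *: z.2 >].

Lemma span_closed M (G : M -> Prop) : GRing.subsemimod_closed (span G).
Proof.
split; first split.
- by apply/asboolP; exists [::]; rewrite big_nil.
- move=> _ _ /asboolP[s [sG ->]] /asboolP[t [tG ->]].
  apply/asboolP; exists (s ++ t); split; last by rewrite big_cat.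
  by move=> z; rewrite mem_cat => /orP[/sG|/tG].
- move=> a _ /asboolP[s [sG ->]].
  apply/asboolP; exists [seq (a * z.1, z.2) | z <- s]; split.
    by move=> _ /mapP[z /sG Gz ->].
  by rewrite big_map scaler_sumr; apply: eq_bigr => z _; rewrite scalerA.
Qed.

HB.instance Definition _ M (G : M -> Prop) :=
  GRing.isSubmodClosed.Build R M (span G) (span_closed G).

Lemma span_gen M (G : M -> Prop) x : G x -> x \in span G.
Proof.
move=> Gx; apply/asboolP; exists [:: (1, x)].
by rewrite big_seq1 scale1r; split=> // z; rewrite inE => /eqP->.
Qed.

Lemma span_sub M (G : M -> Prop) (A : submodClosed M) :
  (forall x, G x -> x \in A) -> {subset span G <= A}.
Proof.
move=> GA _ /asboolP[s [sG ->]]; rewrite big_seq; apply: rpred_sum => z zs.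
by apply/rpredZ/GA/sG.
Qed.

Definition submodD M (A B : submodClosed M) : {pred M} := fun x =>
  `[< exists a b, [/\ a \in A, b \in B & x = a + b] >].

Lemma submodD_closed M (A B : submodClosed M) :
  GRing.subsemimod_closed (submodD A B).
Proof.
split; first split.
- by apply/asboolP; exists 0, 0; rewrite addr0 !rpred0.
- move=> _ _ /asboolP[a [b [aA bB ->]]] /asboolP[a' [b' [aA' bB' ->]]].
  by apply/asboolP; exists (a + a'), (b + b'); rewrite addrACA !rpredD.
- move=> c _ /asboolP[a [b [aA bB ->]]].
  by apply/asboolP; exists (c *: a), (c *: b); rewrite scalerDr !rpredZ.
Qed.

HB.instance Definition _ M (A B : submodClosed M) :=
  GRing.isSubmodClosed.Build R M (submodD A B) (submodD_closed A B).

Definition limage M N (f : {linear M -> N}) (A : submodClosed M) : {pred N} :=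
  fun y => `[< exists2 x, x \in A & y = f x >].

Lemma limage_closed M N (f : {linear M -> N}) (A : submodClosed M) :
  GRing.subsemimod_closed (limage f A).
Proof.
split; first split.
- by apply/asboolP; exists 0; rewrite ?rpred0 ?linear0.
- move=> _ _ /asboolP[x xA ->] /asboolP[y yA ->].
  by apply/asboolP; exists (x + y); rewrite ?rpredD ?linearD.
- move=> c _ /asboolP[x xA ->].
  by apply/asboolP; exists (c *: x); rewrite ?rpredZ ?linearZ.
Qed.

HB.instance Definition _ M N (f : {linear M -> N}) (A : submodClosed M) :=
  GRing.isSubmodClosed.Build R N (limage f A) (limage_closed f A).

Definition lpreim M N (f : {linear M -> N}) (B : submodClosed N) : {pred M} :=
  fun x => f x \in B.

Lemma lpreim_closed M N (f : {linear M -> N}) (B : submodClosed N) :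
  GRing.subsemimod_closed (lpreim f B).
Proof.
split; first split.
- by apply: etrans (rpred0 B); rewrite -(linear0 f).
- move=> x y xB yB; have: f x + f y \in B by exact: rpredD.
  by rewrite -linearD.
- move=> c x xB; have: c *: f x \in B by exact: rpredZ.
  by rewrite -linearZ.
Qed.

HB.instance Definition _ M N (f : {linear M -> N}) (B : submodClosed N) :=
  GRing.isSubmodClosed.Build R M (lpreim f B) (lpreim_closed f B).

Definition sub0 M : {pred M} := pred1 0.

Lemma sub0_closed M : GRing.subsemimod_closed (@sub0 M).
Proof.
split; first split; rewrite ?inE //.
- by move=> x y; rewrite !inE => /eqP-> /eqP->; rewrite addr0.
- by move=> c x; rewrite !inE => /eqP->; rewrite scaler0.
Qed.

HB.instance Definition _ M :=
  GRing.isSubmodClosed.Build R M (@sub0 M) (@sub0_closed M).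

Definition subT M : {pred M} := predT.

Lemma subT_closed M : GRing.subsemimod_closed (@subT M).
Proof. by split; first split. Qed.

HB.instance Definition _ M :=
  GRing.isSubmodClosed.Build R M (@subT M) (@subT_closed M).

Section SubType.
Variables (M : lmodType R) (A : submodClosed M).

Definition submod_type : Type := {x : M | (A : {pred M}) x}.

HB.instance Definition _ := SubChoice.on submod_type.
HB.instance Definition _ :=
  GRing.SubChoice_isSubLmodule.Build R M (A : {pred M}) submod_type
    (GRing.subsemimodClosedP A).

End SubType.

(* The library only provides the additive group structure on {quot A}.        *)
Section QuotientModule.
Variables (M : lmodType R) (A : submodClosed M).

Definition zmod_of : {pred M} := A.

HB.instance Definition _ :=
  GRing.isZmodClosed.Build M zmod_of
    (GRing.subsemimod_closedB (GRing.subsemimodClosedP A)).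

Definition lquot : Type := Quotient.quot zmod_of.

HB.instance Definition _ := GRing.Zmodule.on lquot.

Definition lquot_pi (x : M) : lquot := \pi_(Quotient.quot zmod_of) x.

Definition lquot_scale (c : R) (x : lquot) : lquot :=
  lquot_pi (c *: repr (x : Quotient.quot zmod_of)).

Lemma lquot_piP x y : lquot_pi x = lquot_pi y <-> x - y \in A.
Proof.
rewrite -[x - y \in A]/(x - y \in zmod_of) Quotient.idealrBE.
by split => [/eqP|/eqP].
Qed.

Lemma lquot_reprK (x : lquot) : lquot_pi (repr (x : Quotient.quot zmod_of)) = x.
Proof. exact: reprK. Qed.

Lemma lquot_piB : zmod_morphism lquot_pi.
Proof. by move=> x y; rewrite /lquot_pi raddfB. Qed.

HB.instance Definition _ :=
  GRing.isZmodMorphism.Build M lquot lquot_pi lquot_piB.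

Lemma lquot_scaleE c x : lquot_scale c (lquot_pi x) = lquot_pi (c *: x).
Proof.
by apply/lquot_piP; rewrite -scalerBr rpredZ //; apply/lquot_piP/lquot_reprK.
Qed.

Lemma lquot_scalerA a b v :
  lquot_scale a (lquot_scale b v) = lquot_scale (a * b) v.
Proof. by rewrite -[v]lquot_reprK !lquot_scaleE scalerA. Qed.

Lemma lquot_scale1r : left_id 1 lquot_scale.
Proof. by move=> v; rewrite -[v]lquot_reprK lquot_scaleE scale1r. Qed.

Lemma lquot_scalerDr : right_distributive lquot_scale +%R.
Proof.
move=> a u v; rewrite -[u]lquot_reprK -[v]lquot_reprK.
by rewrite -raddfD !lquot_scaleE -raddfD scalerDr.
Qed.

Lemma lquot_scalerDl v : {morph lquot_scale^~ v : a b / a + b}.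
Proof.
by move=> a b; rewrite -[v]lquot_reprK !lquot_scaleE scalerDl raddfD.
Qed.

HB.instance Definition _ := GRing.Zmodule_isLmodule.Build R lquot
  lquot_scalerA lquot_scale1r lquot_scalerDr lquot_scalerDl.

Lemma lquot_pi_scalable : scalable lquot_pi.
Proof. by move=> a x; apply: esym (lquot_scaleE a x). Qed.

HB.instance Definition _ :=
  GRing.isScalable.Build R M lquot *:%R lquot_pi lquot_pi_scalable.

End QuotientModule.

End Modules.

Arguments sub0 {R} M.
Arguments subT {R} M.

(* The ring k[x_v : v in V]; see [var] for the variables.  Degrees are in Z^V *)
(* because Ext modules are a priori only Z^V-graded.                          *)

Notation polyring k V := {mpoly k[#|(V : finType)|]}.
Notation degree V := {ffun (V : finType) -> int}.

Section Graded.
Variables (k : fieldType) (V : finType).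
Local Notation S := (polyring k V).
Local Notation deg := (degree V).

Definition var (v : V) : S := 'X_(enum_rank v).

Definition eps (v : V) : deg := [ffun u => (u == v)%:R].
Definition ones : deg := [ffun => 1].
Definition mondeg (m : 'X_{1..#|V|}) : deg := [ffun v => (m (enum_rank v))%:Z].

(* A module together with a family of subsets [gr b], to be thought of as its *)
(* homogeneous parts; [is_graded] says that this family is a Z^V-grading.     *)
Record gmod := GMod { gcarrier :> lmodType S; gr : deg -> gcarrier -> Prop }.

Definition is_graded (M : gmod) : Prop :=
  [/\ forall b, gr b (0 : M)
        /\ forall (c : k) (x y : M), gr b x -> gr b y -> gr b (c%:MP *: x + y),
      forall b v (x : M), gr b x -> gr (b + eps v) (var v *: x),
      forall x : M, exists (s : seq deg) (f : deg -> M),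
        (forall b, gr b (f b)) /\ x = \sum_(b <- s) f b
    & forall (s : seq deg) (f : deg -> M), uniq s -> (forall b, gr b (f b)) ->
        \sum_(b <- s) f b = 0 -> forall b, b \in s -> f b = 0].

Definition giso (M N : gmod) : Prop :=
  exists f : {linear M -> N},
    bijective f /\ forall b x, gr b x <-> gr b (f x).

Definition finitely_generated (M : lmodType S) : Prop :=
  exists s : seq M, forall x, x \in span (fun y => y \in s).

Definition homogeneous (b : deg) (p : S) : Prop :=
  forall m, m \in msupp p -> mondeg m = b.

Definition gpoly : gmod := GMod (gcarrier := S^o) homogeneous.

Definition gshift (M : gmod) (a : deg) : gmod :=
  GMod (gcarrier := M) (fun b => gr (a + b)).

Definition gsub (M : gmod) (A : submodClosed M) : gmod :=
  GMod (gcarrier := submod_type A) (fun b z => gr b (val z)).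

Definition gquot (M : gmod) (A : submodClosed M) : gmod :=
  GMod (gcarrier := lquot A) (fun b z => exists2 x, gr b x & z = lquot_pi A x).

(* A resolution of M by the graded free modules of finite rank                *)
(*   F_i = S(-fdeg i 0) + ... + S(-fdeg i (frk i - 1)),                       *)
(* whose elements are row vectors; d : F_(i+1) -> F_i is v |-> v *m fdiff i.  *)
Record free_resolution (M : gmod) := FreeResolution {
  frk : nat -> nat;
  fdeg : forall i, 'I_(frk i) -> deg;
  fdiff : forall i, 'M[S]_(frk i.+1, frk i);
  faug : {linear 'rV[S]_(frk 0) -> M};
  fdiff_homogeneous :
    forall i (s : 'I_(frk i.+1)) (t : 'I_(frk i)),
      homogeneous (fdeg s - fdeg t) (fdiff i s t);
  faug_homogeneous : forall t, gr (fdeg t) (faug (delta_mx 0 t));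
  faug_surj : forall x, exists v, faug v = x;
  faug_exact : forall v, faug v = 0 <-> exists w, v = w *m fdiff 0;
  fdiff_exact : forall i (v : 'rV_(frk i.+1)),
    v *m fdiff i = 0 <-> exists w, v = w *m fdiff i.+1
}.

(* Ext^i_S(M, N) as the cohomology of Hom_S(F, N); up to isomorphism it does  *)
(* not depend on the resolution F of M.                                       *)
Section Ext.
Variables (M : gmod) (F : free_resolution M) (N : gmod).

(* Hom_S(F_i, N): a homomorphism is given by the images of the basis vectors, *)
(* and it has degree b if it raises degrees by b.                             *)
Definition ghom_free (i : nat) : gmod :=
  GMod (gcarrier := {ffun 'I_(frk F i) -> N})
       (fun b h => forall t, gr (b + fdeg t) (h t)).

Definition codiff (i : nat) (h : ghom_free i) : ghom_free i.+1 :=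
  [ffun s => \sum_t fdiff F i s t *: h t].

Lemma codiff_linear i : linear (@codiff i).
Proof.
move=> c g h; apply/ffunP=> s; rewrite !ffunE scaler_sumr -big_split /=.
apply: eq_bigr => t _; rewrite !ffunE scalerDr !scalerA.
by congr (_ *: _ + _); rewrite mulrC.
Qed.

HB.instance Definition _ i :=
  GRing.isLinear.Build S (ghom_free i) (ghom_free i.+1) *:%R (@codiff i)
    (@codiff_linear i).

Definition cocycles i : submodClosed (ghom_free i) :=
  lpreim (@codiff i) (sub0 (ghom_free i.+1)).

Definition coboundaries i : submodClosed (ghom_free i) :=
  match i with
  | 0 => sub0 (ghom_free 0)
  | j.+1 => limage (@codiff j) (subT (ghom_free j))
  end.

Definition Ext (i : nat) : gmod :=
  gquot (M := gsub (cocycles i))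
    (lpreim (val : submod_type (cocycles i) -> ghom_free i) (coboundaries i)).

End Ext.

Definition squarefree (M : gmod) : Prop :=
  [/\ is_graded M,
      forall (b : deg) (x : M), gr b x -> x != 0 -> forall v, 0 <= b v,
      finitely_generated M
    & forall (b : deg) v, (forall u, 0 <= b u) -> 1 <= b v ->
        (forall x y : M, gr b x -> gr b y -> var v *: x = var v *: y -> x = y)
        /\ forall y : M, gr (b + eps v) y -> exists2 x, gr b x & var v *: x = y].

(* [f] restricts to an element of Hom_k(M_b, k).                              *)
Definition dual_elt (M : gmod) (b : deg) (f : M -> k) : Prop :=
  forall (c : k) (x y : M), gr b x -> gr b y ->
    f (c%:MP *: x + y) = c * f x + f y.

(* D is an Alexander dual M^* of M: [phi b] is the isomorphism                *)
(* D_b -> Hom_k(M_(1-b), k) for 0/1-vectors b, and the last clause says that  *)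
(* x_v : D_b -> D_(b+eps v) is dual to x_v : M_(1-b-eps v) -> M_(1-b).  This  *)
(* determines D up to isomorphism, as D is squarefree.                        *)
Definition alexander_dual_module (M D : gmod) : Prop :=
  squarefree D /\
  exists phi : deg -> D -> M -> k,
    forall b : deg, (forall v, b v = 0 \/ b v = 1) ->
    [/\ forall u, gr b u -> dual_elt (ones - b) (phi b u),
        forall x, gr (ones - b) x -> dual_elt b (fun u => phi b u x),
        forall u, gr b u -> (forall x, gr (ones - b) x -> phi b u x = 0) -> u = 0,
        forall f, dual_elt (ones - b) f -> exists2 u, gr b u
          & forall x, gr (ones - b) x -> phi b u x = f x
      & forall v u x, b v = 0 -> gr b u -> gr (ones - b - eps v) x ->
          phi (b + eps v) (var v *: u) x = phi b u (var v *: x)].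

Definition ideal_gen (G : S -> Prop) : submodClosed gpoly :=
  span (M := S^o) G.

(* Meaningful when I is a squarefree monomial ideal.                          *)
Definition alexander_dual_ideal (I : submodClosed gpoly) : submodClosed gpoly :=
  ideal_gen (fun p => exists2 m : 'X_{1..#|V|}, p = 'X_[m] &
    forall m' : 'X_{1..#|V|}, 'X_[m'] \in I ->
      exists c : 'X_{1..#|V|}, [/\ c != 0%MM, (c <= m)%MM & (c <= m')%MM]).

Definition sqfree_mon (F : {set V}) : S := \prod_(v in F) var v.

Definition stanley_reisner_ideal (Delta : {set V} -> Prop) :
    submodClosed gpoly :=
  ideal_gen (fun p => exists2 F : {set V}, p = sqfree_mon F & ~ Delta F).

Lemma alexander_dual_is_stanley_reisner (I : submodClosed gpoly) :
  stanley_reisner_ideal (fun F => sqfree_mon F \notin alexander_dual_ideal I)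
    =i alexander_dual_ideal I.
Proof.
have sqfE F : sqfree_mon F = 'X_[\sum_(v in F) U_(enum_rank v)].
  by rewrite /sqfree_mon mprodXE.
move=> p; apply/idP/idP.
  apply: span_sub p => _ [F -> nF].
  by case: (boolP (sqfree_mon F \in alexander_dual_ideal I)) nF.
apply: span_sub p => _ [m -> mI].
pose F := [set v | (0 < m (enum_rank v))%N].
pose mF := (\sum_(v in F) U_(enum_rank v))%MM.
have mFE v : mF (enum_rank v) = (0 < m (enum_rank v))%N.
  rewrite /mF mnm_sumE (eq_bigr (fun u => (u == v : nat))); last first.
    by move=> u _; rewrite mnm1E (inj_eq enum_rank_inj).
  case: (ltnP 0 (m (enum_rank v))) => mv.
    rewrite (bigD1 v) ?inE //= eqxx big1 ?addn0 // => u /andP[_ /negPf->] //.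
  rewrite big1 // => u; rewrite inE; case: eqP => // ->.
  by rewrite ltnNge mv.
have FA : sqfree_mon F \in alexander_dual_ideal I.
  rewrite sqfE; apply: span_gen; exists mF => // m' /mI[c [c0 cm cm']].
  have [i ci] : exists i, (0 < c i)%N.
    apply/existsP; apply: contraNT c0; rewrite negb_exists => /forallP c0.
    by apply/eqP/mnmP => i; rewrite mnm0E; apply/eqP; rewrite -leqn0 leqNgt.
  have le1 (q : 'X_{1..#|V|}) : (0 < q i)%N -> (U_(i) <= q)%MM by rewrite lep1mP -lt0n.
  exists U_(i)%MM; split.
  - by apply/negP => /eqP/mnmP/(_ i); rewrite mnm1E eqxx mnm0E.
  - apply: le1; rewrite -[i]enum_valK mFE enum_valK lt0b.
    exact: leq_trans ci (mnm_lepP cm i).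
  - exact: le1 (leq_trans ci (mnm_lepP cm' i)).
have mFm : (mF <= m)%MM.
  by apply/mnm_lepP => i; rewrite -[i]enum_valK mFE; case: (m _).
have -> : 'X_[m] = 'X_[m - mF] *: (sqfree_mon F : gpoly).
  by rewrite sqfE; apply: etrans (mpolyXD _ _ _); rewrite submK.
by apply/rpredZ/span_gen; exists F => //; rewrite FA.
Qed.

Definition stanley_reisner_ring (Delta : {set V} -> Prop) : gmod :=
  gquot (stanley_reisner_ideal Delta).

End Graded.

Arguments gpoly k V : clear implicits.
Arguments ones {V}.

(* The chain [n] = {1 < ... < n} is represented by 'I_n = {0 < ... < n-1}.    *)

Section Letterplace.
Variables (k : fieldType) (d : Order.disp_t) (P : finPOrderType d) (n : nat).

Definition isotone (f : {ffun P -> 'I_n}) : bool :=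
  [forall p, forall q, (p <= q)%O ==> (f p <= f q)%N].

Definition isotone_map := {f : {ffun P -> 'I_n} | isotone f}.

Definition isotone_le (f g : isotone_map) : bool :=
  [forall p, (val f p <= val g p)%N].

Definition poset_ideal (J : {set isotone_map}) : Prop :=
  forall f g, isotone_le f g -> g \in J -> f \in J.

Local Notation PV := (P * 'I_n)%type.
Local Notation S := (polyring k PV).

Definition graph_mon (f : isotone_map) : S := \prod_p var k (p, val f p).

Definition ideal_L (J : {set isotone_map}) : submodClosed (gpoly k PV) :=
  ideal_gen (fun m => exists2 f, f \in J & m = graph_mon f).

Definition ideal_BP : submodClosed (gpoly k PV) :=
  ideal_gen (fun m => exists (p q : P) (i j : 'I_n),
    [/\ (p < q)%O, (j < i)%N & m = var k (p, i) * var k (q, j)]).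

Definition ideal_B (J : {set isotone_map}) : submodClosed (gpoly k PV) :=
  submodD (ideal_L (~: J)) ideal_BP.

Definition module_LB (J : {set isotone_map}) : gmod k PV :=
  gsub (M := gquot (ideal_B J)) (limage (lquot_pi (ideal_B J)) (ideal_L J)).

Definition Delta (J : {set isotone_map}) (F : {set PV}) : Prop :=
  sqfree_mon k F \notin alexander_dual_ideal (ideal_L J).

Lemma stanley_reisner_Delta (J : {set isotone_map}) :
  stanley_reisner_ideal k (Delta J) =i alexander_dual_ideal (ideal_L J).
Proof. exact: alexander_dual_is_stanley_reisner. Qed.

(* Ext^|P|_S(k[Delta(J)], S(-1)), computed from the resolution F.             *)
Definition canonical_module (J : {set isotone_map})
    (F : free_resolution (stanley_reisner_ring k (Delta J))) : gmod k PV :=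
  Ext F (gshift (gpoly k PV) (- ones)) #|P|.

End Letterplace.

(* Main.v *)
(* The row monomials a_p = prod_i x_(p,i) form a regular sequence of length    *)
(* |P| in the ideal I = L(J)^A, and their degrees add up to 1.  Hence (Rees)   *)
(* Ext^|P|(S/I, S(-1)) = Hom(S/I, S/(a)) = ((a) : I)/(a).  For a set X of      *)
(* variables, the monomial x^X lies in (a) : I but not in (a) iff some map     *)
(* P -> [n] has its graph in the complement of X and all such maps are in J;   *)
(* this says exactly that the monomial of the complement of X lies in L(J) but *)
(* not in B(J).  So both modules have dimension at most one in each squarefree *)
(* degree, and the product of the coefficients is the duality pairing.         *)

Require Import Defs.
From HB Require Import structures.
From mathcomp Require Import all_boot all_order all_algebra.
From mathcomp Require Import boolp mpoly.

Set Implicit Arguments.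
Unset Strict Implicit.
Unset Printing Implicit Defensive.

Import Order.TTheory GRing.Theory Num.Theory.
Local Open Scope ring_scope.

(** * Monomial ideals and homogeneous components *)

(** Write I for L(J)^A and a_0, ..., a_(c-1) for the row monomials, c = |P|. Their supports are
    disjoint, so each is a nonzerodivisor modulo the later ones, and they lie in I, so they kill
    S/I. The sequences 0 -> S/(a_(j+1), ...) -> S/(a_(j+1), ...) -> S/(a_j, ...) -> 0 give
    connecting maps from Ext^j(S/I, S/(a_j, ...)) to Ext^(j+1)(S/I, S/(a_(j+1), ...)). These are
    onto because a_j acts on Ext as zero ([homotopy], [connect_surj]), and injective because
    Ext^j(S/I, S/(a_(j+1), ...)) vanishes ([bdry_vanish], [connect_bdryW]). Composing all c of them
    ([zigzag]) identifies Hom(S/I, S/(a)) with Ext^c(S/I, S) and lowers degrees by the all-ones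
    vector, which the twist S(-1) undoes. A homomorphism S/I -> S/(a) is determined by the image of
    1, so the source is ((a) : I)/(a); this is [Ext_colon_quot].

    What remains is combinatorics. All ideals involved are squarefree monomial ideals, so in a
    0/1-degree both ((a) : I)/(a) and L(J|B) are k or 0. By [colon_L_dual] the first is nonzero in
    degree X iff the second is nonzero in the complementary degree, and [colon_quot_dual] turns this
    into Alexander duality. *)

Section MonomialIdeals.
Variables (k : fieldType) (N : nat).
Local Notation S := {mpoly k[N]}.
Implicit Types (p q : S) (m e : 'X_{1..N}) (U : 'X_{1..N} -> Prop).

(** A monomial ideal is represented by the set [U] of exponents of its monomials, so that ideal
    arithmetic becomes reasoning about single exponents. *)
Definition mideal U p : Prop := forall m, p@_m != 0 -> U m.

Lemma mideal0 U : mideal U 0.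
Proof. by move=> m; rewrite mcoeff0 eqxx. Qed.

Lemma midealD U p q : mideal U p -> mideal U q -> mideal U (p + q).
Proof.
move=> pU qU m; rewrite mcoeffD => pqm.
have [pm0|/pU//] := eqVneq p@_m 0.
by apply: qU; rewrite pm0 add0r in pqm.
Qed.

Lemma mideal_sum U (I : Type) (r : seq I) (P : pred I) (f : I -> S) :
  (forall i, P i -> mideal U (f i)) -> mideal U (\sum_(i <- r | P i) f i).
Proof. by move=> fU; elim/big_ind: _ => //; [exact: mideal0|exact: midealD]. Qed.

Lemma mideal_sub U U' p : (forall m, U m -> U' m) -> mideal U p -> mideal U' p.
Proof. by move=> UU' pU m /pU/UU'. Qed.

Lemma midealM U1 U2 U p q : (forall m1 m2, U1 m1 -> U2 m2 -> U (m1 + m2)%MM) ->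
  mideal U1 p -> mideal U2 q -> mideal U (p * q).
Proof.
move=> UP pU qU m; rewrite -mcoeff_msupp => /msuppM_le/allpairsP[[m1 m2] /=].
by rewrite !mcoeff_msupp => -[/pU Um1 /qU Um2 ->]; apply: UP.
Qed.

Definition upclosed U : Prop := forall m e, U m -> U (e + m)%MM.

Lemma mideal_mull U p q : upclosed U -> mideal U p -> mideal U (q * p).
Proof. by move=> Uup; apply: (@midealM xpredT) => // m1 m2 _ /Uup. Qed.

Lemma midealN U p : mideal U p -> mideal U (- p).
Proof. by move=> pU m; rewrite mcoeffN oppr_eq0 => /pU. Qed.

Lemma midealB U p q : mideal U p -> mideal U q -> mideal U (p - q).
Proof. by move=> pU /midealN; apply: midealD. Qed.

Lemma midealX U m : mideal U 'X_[m] <-> U m.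
Proof.
split=> [|Um m']; first by apply; rewrite mcoeffX eqxx oner_eq0.
by rewrite mcoeffX; have [<-|_] := eqVneq m m'; rewrite // eqxx.
Qed.

Lemma midealMX U e p : mideal U ('X_[e] * p) -> mideal (fun m => U (e + m)%MM) p.
Proof. by move=> pU m pm; apply: pU; rewrite mulrC mcoeffMX. Qed.

(** The witness collects the terms of [p] divisible by ['X_[e]]; the terms left over have exponents
    in [U]. *)
Lemma mideal_split U U' e p :
  (forall m, U' m -> U m \/ (e <= m)%MM) -> mideal U' p ->
  exists q, mideal U (p - 'X_[e] * q).
Proof.
move=> UU' pU'.
exists (\sum_(m <- msupp p | (e <= m)%MM) p@_m *: 'X_[m - e]).
rewrite mulr_sumr {1}[p]mpolyE (bigID (fun m => (e <= m)%MM)) /= addrAC -sumrB.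
rewrite big1_seq ?add0r => [|m /andP[em _]]; last first.
  by rewrite -scalerAr -mpolyXD addmC submK // subrr.
rewrite big_seq_cond; apply: mideal_sum => m /andP[]; rewrite mcoeff_msupp.
move=> /pU'/UU'[Um|->] // _ m'; rewrite mcoeffZ mcoeffX.
by have [<-//|_] := eqVneq m m'; rewrite mulr0 eqxx.
Qed.

Lemma mideal_False p : mideal (fun=> False) p <-> p = 0.
Proof.
split=> [pF|->]; last exact: mideal0.
by apply/mpolyP => m; rewrite mcoeff0; apply/eqP/negPn/negP => /pF.
Qed.

End MonomialIdeals.

Section Degrees.
Variables (k : fieldType) (V : finType).
Local Notation S := (polyring k V).
Implicit Types (p q : S) (m e : 'X_{1..#|V|}) (b : degree V).

Lemma mondegD m1 m2 : mondeg (m1 + m2) = mondeg m1 + mondeg m2 :> degree V.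
Proof. by apply/ffunP=> v; rewrite !ffunE mnmDE PoszD. Qed.

Lemma mondeg_inj : injective (@mondeg V).
Proof.
move=> m1 m2 /ffunP m12; apply/mnmP => i.
by have := m12 (enum_val i); rewrite !ffunE enum_valK => -[].
Qed.

Lemma mondegU (v : V) : mondeg U_(enum_rank v) = eps v.
Proof.
apply/ffunP=> u; rewrite !ffunE mnm1E (inj_eq enum_rank_inj) eq_sym.
by case: eqP.
Qed.

Lemma homogeneousP b p : homogeneous b p <-> forall m, p@_m != 0 -> mondeg m = b.
Proof. by split=> h m; have := h m; rewrite mcoeff_msupp. Qed.

Lemma homogeneousX m : homogeneous (mondeg m) ('X_[m] : S).
Proof. by move=> m'; rewrite msuppX inE => /eqP->. Qed.

Lemma homogeneous0 b : homogeneous b (0 : S).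
Proof. by move=> m; rewrite msupp0. Qed.

Lemma homogeneousE m p : homogeneous (mondeg m) p -> p = p@_m *: 'X_[m].
Proof.
move=> /homogeneousP pm; apply/mpolyP => m'; rewrite mcoeffZ mcoeffX.
have [->|ne] := eqVneq m m'; first by rewrite mulr1.
rewrite mulr0; apply/eqP/negPn/negP => /pm /mondeg_inj E.
by rewrite E eqxx in ne.
Qed.

Definition hcomp b p : S := \sum_(m <- msupp p | mondeg m == b) p@_m *: 'X_[m].

Lemma mcoeff_hcomp b p m : (hcomp b p)@_m = if mondeg m == b then p@_m else 0.
Proof.
rewrite /hcomp raddf_sum /=; under eq_bigr do rewrite mcoeffZ mcoeffX.
case: (boolP (m \in msupp p)) => pm.
  rewrite big_mkcond (bigD1_seq m) //= eqxx mulr1 big1 ?addr0 // => m' m'm.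
  by rewrite (negPf m'm) mulr0 if_same.
rewrite big1_seq => [|m' /andP[_ pm']].
  by move: pm; rewrite mcoeff_msupp negbK => /eqP->; rewrite if_same.
by case: eqP => [E|]; rewrite ?mulr0 //; rewrite -E pm' in pm.
Qed.

Lemma hcomp_linear b : linear (hcomp b).
Proof.
move=> c p q; apply/mpolyP => m; rewrite mcoeffD mcoeffZ !mcoeff_hcomp.
by case: ifP; rewrite ?mcoeffD ?mcoeffZ ?mulr0 ?addr0.
Qed.

HB.instance Definition _ b :=
  GRing.isLinear.Build k S S *:%R (hcomp b) (hcomp_linear b).

Lemma hcomp_homogeneous b p : homogeneous b (hcomp b p).
Proof.
apply/homogeneousP => m; rewrite mcoeff_hcomp.
by case: (mondeg m =P b); rewrite ?eqxx.
Qed.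

Lemma hcomp_id b p : homogeneous b p -> hcomp b p = p.
Proof.
move=> /homogeneousP pb; apply/mpolyP => m; rewrite mcoeff_hcomp.
by case: eqP => // mb; apply/esym/eqP/negPn/negP => /pb.
Qed.

Lemma hcompX b m : hcomp b 'X_[m] = if mondeg m == b then 'X_[m] else 0.
Proof.
apply/mpolyP => m'; rewrite mcoeff_hcomp (fun_if (mcoeff m')) mcoeff0 !mcoeffX.
by have [->|_] := eqVneq m m'; rewrite // !if_same.
Qed.

Lemma hcompM b (e : degree V) q p :
  homogeneous e q -> hcomp (e + b) (q * p) = q * hcomp b p.
Proof.
move=> qe; rewrite [q]mpolyE [p]mpolyE !linear_sum !mulr_suml linear_sum /=.
rewrite big_seq [RHS]big_seq; apply: eq_bigr => m1 /qe m1e.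
rewrite !mulr_sumr linear_sum /=; apply: eq_bigr => m2 _.
rewrite -scalerAr -scalerAl !linearZ /= -scalerAl -mpolyXD !hcompX.
rewrite mondegD m1e (inj_eq (addrI e)).
case: ifP => _; rewrite ?scaler0 ?mulr0 ?scaler0 //.
by rewrite mpolyXD -scalerAr !scalerA mulrC.
Qed.

Lemma mideal_hcomp U b p : mideal U p -> mideal U (hcomp b p).
Proof.
by move=> pU m; rewrite mcoeff_hcomp; case: ifP => [_ /pU|]; rewrite ?eqxx.
Qed.

Lemma hcomp_sum p : p = \sum_(b <- undup (map (@mondeg V) (msupp p))) hcomp b p.
Proof.
apply/mpolyP => m; rewrite raddf_sum /=; under eq_bigr do rewrite mcoeff_hcomp.
case: (boolP (m \in msupp p)) => pm.
  rewrite (bigD1_seq (mondeg m)) ?undup_uniq ?mem_undup ?map_f //= eqxx.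
  by rewrite big1 ?addr0 // => b; rewrite eq_sym => /negPf->.
move: (pm); rewrite mcoeff_msupp negbK => /eqP->; rewrite big1 // => b _.
by rewrite if_same.
Qed.

(** A squarefree monomial ideal sees an exponent only through its support, so such ideals are given
    below by predicates on [vars m]. *)
Definition vars m : {set V} := [set v | (0 < m (enum_rank v))%N].
Definition sqfree_mnm (A : {set V}) : 'X_{1..#|V|} := (\sum_(v in A) U_(enum_rank v))%MM.

Lemma sqfree_mnmE A v : sqfree_mnm A (enum_rank v) = (v \in A).
Proof.
rewrite /sqfree_mnm mnm_sumE (eq_bigr (fun u => (u == v : nat))); last first.
  by move=> u _; rewrite mnm1E (inj_eq enum_rank_inj).
have [Av|nAv] := boolP (v \in A).
  by rewrite (bigD1 v) //= eqxx big1 ?addn0 // => u /andP[_ /negPf->].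
by rewrite big1 // => u Au; case: eqP => // E; rewrite -E Au in nAv.
Qed.

Lemma vars_sqfree A : vars (sqfree_mnm A) = A.
Proof. by apply/setP=> v; rewrite inE sqfree_mnmE lt0b. Qed.

Lemma varsD m1 m2 : vars (m1 + m2) = vars m1 :|: vars m2.
Proof. by apply/setP=> v; rewrite !inE mnmDE addn_gt0. Qed.

Lemma varsU (v : V) : vars U_(enum_rank v) = [set v].
Proof.
by apply/setP=> u; rewrite !inE mnm1E (inj_eq enum_rank_inj) lt0b eq_sym.
Qed.

Lemma sqfree_mnm_le A m : (sqfree_mnm A <= m)%MM = (A \subset vars m).
Proof.
apply/mnm_lepP/subsetP => [le v Av|sub i].
  by rewrite inE; have := le (enum_rank v); rewrite sqfree_mnmE Av.
rewrite -[i]enum_valK sqfree_mnmE; case: (boolP (_ \in A)) => // /sub.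
by rewrite inE.
Qed.

(** The bridge between ideals given by monomial generators and [mideal]: every monomial in [U] is a
    multiple of a generator, and a polynomial is the sum of its terms. *)
Lemma ideal_genP U (G : S -> Prop) : upclosed U ->
  (forall p, G p -> exists2 m, p = 'X_[m] & U m) ->
  (forall m, U m -> exists2 m', (m' <= m)%MM & G 'X_[m']) ->
  forall p, p \in ideal_gen G <-> mideal U p.
Proof.
move=> Uup GU UG p; split.
  move=> /asboolP[s [sG ->]]; rewrite big_seq.
  apply: mideal_sum => z /sG/GU[m -> Um].
  by apply: mideal_mull => //; apply/midealX.
move=> pU; rewrite [p]mpolyE big_seq; apply: rpred_sum => m.
rewrite mcoeff_msupp => /pU/UG[m' m'm Gm'].
have -> : p@_m *: 'X_[m] = ((p@_m)%:MP * 'X_[m - m']) *: ('X_[m'] : gpoly k V).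
  by rewrite -mul_mpolyC -[X in 'X_[X]](submK m'm) mpolyXD mulrA.
by apply/rpredZ/span_gen.
Qed.

End Degrees.

(** * Ext of a module killed by a regular sequence of monomials *)

Section Rees.
Variables (k : fieldType) (V : finType) (M : gmod k V) (F : free_resolution M).
Local Notation S := (polyring k V).
Local Notation D := (fdiff F).
Implicit Types (U : 'X_{1..#|V|} -> Prop) (b : degree V).

Lemma fdiff_comp i : D i.+1 *m D i = 0.
Proof.
apply/row_matrixP => s; rewrite row0 row_mul; apply/fdiff_exact.
by exists (delta_mx 0 s); rewrite -rowE.
Qed.

Lemma fdiff_lift i r (X : 'M_(r, frk F i.+1)) :
  X *m D i = 0 -> exists W, X = W *m D i.+1.
Proof.
move=> XD; have /choice[w wX] : forall s, exists w, row s X = w *m D i.+1.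
  by move=> s; apply/fdiff_exact; rewrite -row_mul XD row0.
by exists (\matrix_s w s); apply/row_matrixP => s; rewrite row_mul rowK.
Qed.

Lemma faug_lift r (X : 'M_(r, frk F 0)) :
  (forall s, faug F (row s X) = 0) -> exists W, X = W *m D 0.
Proof.
move=> XD; have /choice[w wX] : forall s, exists w, row s X = w *m D 0.
  by move=> s; apply/faug_exact.
by exists (\matrix_s w s); apply/row_matrixP => s; rewrite row_mul rowK.
Qed.

Lemma homotopy0 (a : S) : (forall x : M, a *: x = 0) -> exists s, a%:M = s *m D 0.
Proof.
move=> aM; apply: faug_lift => t.
by rewrite -scalemx1 linearZ /= linearZ /= aM.
Qed.

(** Multiplication by [a] on the resolution lifts the zero map of M, hence is null-homotopic. The
    homotopy [s'] found in one degree serves as [s] in the next. *)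
Lemma homotopy (a : S) i : (forall x : M, a *: x = 0) ->
  exists s s', a%:M = D i *m s + s' *m D i.+1.
Proof.
move=> aM; elim: i => [|i [s [s' E]]].
  have [s E] := homotopy0 aM.
  have [|s' E'] := @fdiff_lift 0 _ (a%:M - D 0 *m s).
    by rewrite mulmxBl -mulmxA -E mul_scalar_mx mul_mx_scalar subrr.
  by exists s, s'; rewrite -E' addrC subrK.
have [|s'' E'] := @fdiff_lift i.+1 _ (a%:M - D i.+1 *m s').
  have sD : s' *m D i.+1 = a%:M - D i *m s by rewrite E addrC addKr.
  rewrite mulmxBl -mulmxA sD mulmxBr mulmxA fdiff_comp mul0mx subr0.
  by rewrite mul_scalar_mx mul_mx_scalar subrr.
by exists s', s''; rewrite -E' addrC subrK.
Qed.

(** Cochains with values in S/U are represented by columns over S read modulo [U]; being a cocycle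
    is then [vmem U (D i *m h)]. *)
Definition vmem U r (h : 'cV[S]_r) : Prop := forall t, mideal U (h t 0).

Lemma vmem0 U r : vmem U (0 : 'cV_r).
Proof. by move=> t; rewrite mxE; apply: mideal0. Qed.

Lemma vmemD U r (g h : 'cV_r) : vmem U g -> vmem U h -> vmem U (g + h).
Proof. by move=> gU hU t; rewrite mxE; apply: midealD. Qed.

Lemma vmemB U r (g h : 'cV_r) : vmem U g -> vmem U h -> vmem U (g - h).
Proof. by move=> gU hU t; rewrite !mxE; apply: midealB. Qed.

Lemma vmem_mul U r s (X : 'M_(s, r)) (h : 'cV_r) :
  upclosed U -> vmem U h -> vmem U (X *m h).
Proof.
by move=> Uup hU t; rewrite mxE; apply: mideal_sum => i _; apply: mideal_mull.
Qed.

Lemma vmemZ U r c (h : 'cV_r) : upclosed U -> vmem U h -> vmem U (c *: h).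
Proof. by move=> Uup hU t; rewrite mxE; apply: mideal_mull. Qed.

(** The part of the cochain that raises degrees by [b]: its value on the basis vector of degree
    [fdeg t] has degree [b + fdeg t]. *)
Definition vcomp b i (h : 'cV[S]_(frk F i)) : 'cV[S]_(frk F i) :=
  \col_t hcomp (b + fdeg t) (h t 0).

Lemma vcompB b i (g h : 'cV[S]_(frk F i)) : vcomp b (g - h) = vcomp b g - vcomp b h.
Proof. by apply/colP => t; rewrite !mxE linearB. Qed.

Lemma vmem_vcomp U b i (h : 'cV[S]_(frk F i)) : vmem U h -> vmem U (vcomp b h).
Proof. by move=> hU t; rewrite mxE; apply: mideal_hcomp. Qed.

Lemma vcomp_diff b i (h : 'cV[S]_(frk F i)) : vcomp b (D i *m h) = D i *m vcomp b h.
Proof.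
apply/colP => s; rewrite !mxE linear_sum; apply: eq_bigr => t _ /=.
rewrite mxE -(hcompM _ _ (@fdiff_homogeneous _ _ _ F i s t)).
by congr (hcomp _ _); rewrite [RHS]addrC -addrA (addrC (fdeg t)) subrK.
Qed.

Lemma vcompX b m i (h : 'cV[S]_(frk F i)) :
  vcomp b ('X_[m] *: h) = 'X_[m] *: vcomp (b - mondeg m) h.
Proof.
apply/colP => t; rewrite !mxE -(hcompM _ _ (@homogeneousX _ _ m)).
by congr (hcomp _ _); rewrite addrA (addrC (mondeg m)) subrK.
Qed.

Variables (a : nat -> 'X_{1..#|V|}) (c : nat).

(* Membership of the monomial m in the ideal (a_j, ..., a_(c-1)). *)
Definition tailgen j m : Prop := exists2 l, (j <= l < c)%N & (a l <= m)%MM.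

Lemma tailgen_up j : upclosed (tailgen j).
Proof.
by move=> m e [l lj alm]; exists l => //; apply: lepm_trans alm (lem_addl _ _).
Qed.

Lemma tailgenS j m : tailgen j.+1 m -> tailgen j m.
Proof. by move=> [l /andP[jl lc] alm]; exists l; rewrite // lc (ltnW jl). Qed.

Lemma tailgen_split j m : tailgen j m -> tailgen j.+1 m \/ (a j <= m)%MM.
Proof.
move=> [l /andP[]]; rewrite leq_eqVlt => /predU1P[<- _|jl lc] alm; first by right.
by left; exists l; rewrite ?jl.
Qed.

Hypothesis annM : forall j (x : M), (j < c)%N -> 'X_[a j] *: x = 0.
(** Multiplication by a_j is injective on S/(a_(j+1), ...); for monomial ideals this can be tested
    on monomials. *)
Hypothesis regular :
  forall j m, (j < c)%N -> tailgen j.+1 (a j + m)%MM -> tailgen j.+1 m.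

Lemma vmem_reg j r (h : 'cV_r) : (j < c)%N ->
  vmem (tailgen j.+1) ('X_[a j] *: h) -> vmem (tailgen j.+1) h.
Proof.
move=> jc hU t; have := hU t; rewrite mxE => /midealMX.
by apply: mideal_sub => m; apply: regular.
Qed.

Definition bdry U i : 'cV[S]_(frk F i) -> Prop :=
  match i with
  | 0 => fun h => vmem U h
  | i'.+1 => fun h => exists g, vmem U (h - D i' *m g)
  end.

(* The connecting map of the exact sequence                                     *)
(*   0 -> S/(a_(j+1), ...) -> S/(a_(j+1), ...) -> S/(a_j, a_(j+1), ...) -> 0     *)
(* given by multiplication with a_j sends the class of h to that of h'.         *)
Definition connect i j (h : 'cV[S]_(frk F i)) (h' : 'cV[S]_(frk F i.+1)) : Prop :=
  vmem (tailgen j.+1) (D i *m h - 'X_[a j] *: h').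

Lemma connect_ex i j (h : 'cV[S]_(frk F i)) :
  vmem (tailgen j) (D i *m h) -> exists h', connect j h h'.
Proof.
move=> hU; have /choice[g gU] : forall s, exists g,
    mideal (tailgen j.+1) ((D i *m h) s 0 - 'X_[a j] * g).
  by move=> s; apply: mideal_split (hU s) => m /tailgen_split.
by exists (\col_s g s) => s; have := gU s; rewrite !mxE.
Qed.

(** Applying the differential to the relation between [h] and [h'] leaves a_j times the coboundary
    of [h'] in the tail ideal, where a_j can be cancelled. *)
Lemma connect_cocycle i j (h : 'cV[S]_(frk F i)) h' : (j < c)%N ->
  connect j h h' -> vmem (tailgen j.+1) (D i.+1 *m h').
Proof.
move=> jc /(@vmem_mul _ _ _ (D i.+1) _ (@tailgen_up _)).
rewrite mulmxBr mulmxA fdiff_comp mul0mx sub0r -scalemxAr => hU.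
apply: (vmem_reg jc); rewrite -[X in vmem _ X]opprK -sub0r.
by apply: vmemB => //; apply: vmem0.
Qed.

Lemma connect_cocycleW i j (h : 'cV[S]_(frk F i)) h' : (j < c)%N ->
  connect j h h' -> vmem (tailgen j) (D i *m h).
Proof.
move=> jc hh'; rewrite -[D i *m h](subrK ('X_[a j] *: h')); apply: vmemD.
  by move=> s; apply: mideal_sub (hh' s) => m /tailgenS.
move=> s; rewrite mxE mulrC; apply: mideal_mull; first exact: tailgen_up.
by apply/midealX; exists j; rewrite ?leqnn ?jc ?lepm_refl.
Qed.

(** The homotopy for a_j writes a_j h' as the coboundary of [s *m h'] plus a term that vanishes
    modulo the tail, so [s *m h'] is a preimage. *)
Lemma connect_surj i j (h' : 'cV[S]_(frk F i.+1)) : (j < c)%N ->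
  vmem (tailgen j.+1) (D i.+1 *m h') -> exists h, connect j h h'.
Proof.
move=> jc hU; have [s [s' E]] := homotopy i (fun x => annM x jc).
exists (s *m h'); rewrite /connect -mul_scalar_mx E mulmxDl -!mulmxA.
rewrite opprD addNKr -[X in vmem _ X]add0r.
by apply: vmemB; [exact: vmem0|apply: vmem_mul => //; exact: tailgen_up].
Qed.

(** The connecting map is well defined on classes: modulo the tail, [h] is a cocycle [g] over S plus
    a_j u, and cancelling a_j shows that [h'] is the coboundary of [u]. *)
Lemma connect_bdry i j (h : 'cV[S]_(frk F i)) h' : (j < c)%N ->
  connect j h h' -> bdry (tailgen j) h -> bdry (tailgen j.+1) h'.
Proof.
move=> jc hh' hB; have [g gU] : exists g, vmem (tailgen j) (h - g) /\ D i *m g = 0.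
  case: i h h' hB {hh'} => [|i] h h' /=; first by exists 0; rewrite subr0 mulmx0.
  by move=> [g gU]; exists (D i *m g); rewrite mulmxA fdiff_comp mul0mx.
case: gU => gU Dg.
have /choice[u uU] : forall s, exists u,
    mideal (tailgen j.+1) ((h - g) s 0 - 'X_[a j] * u).
  by move=> s; apply: mideal_split (gU s) => m /tailgen_split.
exists (\col_s u s); apply: (vmem_reg jc).
have -> : 'X_[a j] *: (h' - D i *m \col_s u s) =
    D i *m (h - g - 'X_[a j] *: \col_s u s) - (D i *m h - 'X_[a j] *: h').
  by rewrite !mulmxBr Dg subr0 scalerBr -scalemxAr opprB addrC [X in _ = X]addrC
             addrA subrK addrC.
apply: vmemB => //; apply: vmem_mul; first exact: tailgen_up.
by move=> s; have := uU s; rewrite !mxE.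
Qed.

(* Ext^i(M, S/(a_j, ..., a_(c-1))) = 0 for i < j, which makes the connecting maps *)
(* from Ext^j to Ext^(j+1) injective.                                            *)
Lemma bdry_vanish i j (h : 'cV[S]_(frk F i)) : (i < j <= c)%N ->
  vmem (tailgen j) (D i *m h) -> bdry (tailgen j) h.
Proof.
case: j => // j; rewrite ltnS; elim: i j h => [|i IH] j h /andP[ij jc] hU.
  apply: (vmem_reg jc); have [s E] := homotopy0 (fun x => annM x jc).
  rewrite -mul_scalar_mx E -mulmxA; apply: vmem_mul => //; exact: tailgen_up.
(* [h] comes from a class [g] one degree lower with values in S/(a_j, ...), which is a coboundary by
   induction. *)
have [g gh] := connect_surj jc hU.
apply: connect_bdry (gh) _ => //; case: j ij jc {hU} gh => // j ij jc gh.
by apply: IH; [rewrite -ltnS ij (ltnW jc)|exact: connect_cocycleW gh].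
Qed.

(** Injectivity. If [h'] is the coboundary of [g], then h - a_i g is a cocycle already modulo
    (a_(i+1), ...), where Ext^i vanishes; and a_i g is zero modulo (a_i, ...). *)
Lemma connect_bdryW i (h : 'cV[S]_(frk F i)) h' : (i < c)%N ->
  connect i h h' -> bdry (tailgen i.+1) h' -> bdry (tailgen i) h.
Proof.
move=> ic hh' [g gU].
have : bdry (tailgen i.+1) (h - 'X_[a i] *: g).
  apply: bdry_vanish; first by rewrite leqnn ic.
  have -> : D i *m (h - 'X_[a i] *: g) =
      D i *m h - 'X_[a i] *: h' + 'X_[a i] *: (h' - D i *m g).
    by rewrite mulmxBr scalerBr -scalemxAr addrA subrK.
  by apply: vmemD => //; apply: vmemZ => //; exact: tailgen_up.
have gA : vmem (tailgen i) ('X_[a i] *: g).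
  move=> s; rewrite mxE mulrC; apply: mideal_mull; first exact: tailgen_up.
  by apply/midealX; exists i; rewrite ?leqnn ?ic ?lepm_refl.
case: i h {h' hh'} g ic {gU} gA => [|i] h g ic gA /=.
  move=> hU; rewrite -[h](subrK ('X_[a 0] *: g)); apply: vmemD => // s.
  by apply: mideal_sub (hU s) => m /tailgenS.
move=> [u uU]; exists u; rewrite -[h](subrK ('X_[a i.+1] *: g)) addrAC.
apply: vmemD => // s; by apply: mideal_sub (uU s) => m /tailgenS.
Qed.

Lemma connect_linear i j x (h1 h2 : 'cV[S]_(frk F i)) h1' h2' :
  connect j h1 h1' -> connect j h2 h2' ->
  connect j (x *: h1 + h2) (x *: h1' + h2').
Proof.
move=> c1 c2; rewrite /connect.
have -> : D i *m (x *: h1 + h2) - 'X_[a j] *: (x *: h1' + h2') =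
    x *: (D i *m h1 - 'X_[a j] *: h1') + (D i *m h2 - 'X_[a j] *: h2').
  rewrite mulmxDr -scalemxAr scalerDr scalerBr !scalerA (mulrC x).
  by rewrite opprD addrACA.
by apply: vmemD => //; apply: vmemZ => //; exact: tailgen_up.
Qed.

Lemma connect_vcomp b i j (h : 'cV[S]_(frk F i)) h' :
  connect j h h' -> connect j (vcomp b h) (vcomp (b - mondeg (a j)) h').
Proof. by move/vmem_vcomp => /(_ b); rewrite vcompB vcomp_diff vcompX. Qed.

(** The composite of the first i connecting maps, from Ext^0 with values in S/(a_0, ...) to Ext^i
    with values in S/(a_i, ...). It is a relation because each step chooses representatives. *)
Fixpoint zigzag i (h : 'cV[S]_(frk F 0)) : 'cV[S]_(frk F i) -> Prop :=
  match i with
  | 0 => fun h' => h' = h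
  | i'.+1 => fun h'' => exists2 h', zigzag h h' & connect i' h' h''
  end.

Lemma zigzag_cocycle i h (h' : 'cV[S]_(frk F i)) : (i <= c)%N ->
  vmem (tailgen 0) (D 0 *m h) -> zigzag h h' -> vmem (tailgen i) (D i *m h').
Proof.
case: i h' => [h' _ ? -> //|i h' ic _ [g _ gh]].
exact: connect_cocycle gh.
Qed.

Lemma zigzag_ex i h : (i <= c)%N ->
  vmem (tailgen 0) (D 0 *m h) -> exists h' : 'cV[S]_(frk F i), zigzag h h'.
Proof.
elim: i => [|i IH] ic hU; first by exists h.
have [h' hh'] := IH (ltnW ic) hU.
have [h'' hh''] := connect_ex (zigzag_cocycle (ltnW ic) hU hh').
by exists h'', h'.
Qed.

Lemma zigzag_surj i (h' : 'cV[S]_(frk F i)) : (i <= c)%N ->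
  vmem (tailgen i) (D i *m h') ->
  exists2 h, vmem (tailgen 0) (D 0 *m h) & zigzag h h'.
Proof.
elim: i h' => [|i IH] h' ic hU; first by exists h'.
have [g gh] := connect_surj ic hU.
have [h hU' hg] := IH g (ltnW ic) (connect_cocycleW ic gh).
by exists h => //; exists g.
Qed.

Lemma zigzag_bdry i h (h' : 'cV[S]_(frk F i)) : (i <= c)%N ->
  zigzag h h' -> vmem (tailgen 0) h <-> bdry (tailgen i) h'.
Proof.
elim: i h' => [|i IH] h' ic; first by move=> ->.
move=> [g /(IH _ (ltnW ic))hg gh]; split => [/hg|].
  exact: connect_bdry gh.
by move=> /(connect_bdryW ic gh)/hg.
Qed.

Lemma zigzag_linear i x h1 h2 (h1' h2' : 'cV[S]_(frk F i)) :
  zigzag h1 h1' -> zigzag h2 h2' -> zigzag (x *: h1 + h2) (x *: h1' + h2').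
Proof.
elim: i h1' h2' => [|i IH] h1' h2' /=; first by move=> -> ->.
move=> [g1 z1 c1] [g2 z2 c2]; exists (x *: g1 + g2); first exact: IH.
exact: connect_linear.
Qed.

(** Each connecting map divides by one a_l and so lowers the degree by that of a_l. *)
Lemma zigzag_vcomp b i h (h' : 'cV[S]_(frk F i)) : zigzag h h' ->
  zigzag (vcomp b h) (vcomp (b - \sum_(l < i) mondeg (a l)) h').
Proof.
elim: i h' => [|i IH] h' /=; first by move=> ->; rewrite big_ord0 subr0.
move=> [g /IH zg gh]; exists (vcomp (b - \sum_(l < i) mondeg (a l)) g) => //.
by rewrite big_ord_recr opprD addrA; apply: connect_vcomp.
Qed.

End Rees.

(** Zigzags give a relation between modules, not a function. Linearity together with preservation of
    zero in both directions makes it single-valued and injective. *)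
Lemma giso_rel (k : fieldType) (V : finType) (M N : gmod k V) (R : M -> N -> Prop) :
  (forall c x1 y1 x2 y2, R x1 y1 -> R x2 y2 -> R (c *: x1 + x2) (c *: y1 + y2)) ->
  (forall x, exists y, R x y) -> (forall y, exists x, R x y) ->
  (forall x y, R x y -> x = 0 <-> y = 0) ->
  (forall b x, gr b x -> exists2 y, gr b y & R x y) ->
  (forall b y, gr b y -> exists2 x, gr b x & R x y) -> giso M N.
Proof.
move=> Rlin /choice[f Rf] /choice[g Rg] R0 Rgr Rgr'.
have Rfun x y y' : R x y -> R x y' -> y = y'.
  move=> Ry Ry'; have := Rlin (-1) _ _ _ _ Ry' Ry.
  by rewrite !scaleN1r addNr addrC => /R0[/(_ erefl)/subr0_eq].
have Rinj x x' y : R x y -> R x' y -> x = x'.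
  move=> Rx Rx'; have := Rlin (-1) _ _ _ _ Rx' Rx.
  by rewrite !scaleN1r addNr addrC => /R0[_ /(_ erefl)/subr0_eq].
have flin : linear f by move=> c x y; apply: Rfun (Rf _) _; apply: Rlin.
pose fL : {linear M -> N} := HB.pack f (GRing.isLinear.Build _ _ _ _ _ flin).
exists fL; split; last first.
  move=> b x /=; split=> [/Rgr[y yb xy]|/Rgr'[x' xb xy]].
    by rewrite (Rfun _ _ _ (Rf x) xy).
  by rewrite (Rinj _ _ _ (Rf x) xy).
exists g => [x|y] /=; first exact: Rinj (Rg _) (Rf x).
exact: Rfun (Rf _) (Rg y).
Qed.

Lemma lquot_eq0 (R : comNzRingType) (M : lmodType R) (B : submodClosed M) x :
  lquot_pi B x = 0 <-> x \in B.
Proof. by rewrite -[0 in X in X <-> _](linear0 (lquot_pi B)) lquot_piP subr0. Qed.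

Lemma lquot_surj (R : comNzRingType) (M : lmodType R) (B : submodClosed M)
    (x : lquot B) :
  exists p, x = lquot_pi B p.
Proof. by exists (repr (x : Quotient.quot (zmod_of B))); rewrite lquot_reprK. Qed.

Lemma submod_valP (R : comNzRingType) (M : lmodType R) (B : submodClosed M) x
    (u v : submod_type B) :
  val (x *: u + v) = x *: val u + val v.
Proof. exact: (linearP (val : submod_type B -> M)). Qed.

Lemma submod_valZ (R : comNzRingType) (M : lmodType R) (B : submodClosed M) x
    (u : submod_type B) :
  val (x *: u) = x *: val u.
Proof. by have := submod_valP x u 0; rewrite linear0 !addr0. Qed.

Definition submodI (R : comNzRingType) (M : lmodType R) (B : submodClosed M) x
  (xB : x \in B) : submod_type B := exist _ x xB.

Lemma ideal_mull (k : fieldType) (V : finType) (I : submodClosed (gpoly k V))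
    (p q : polyring k V) : q \in I -> p * q \in I.
Proof. exact: (@rpredZ _ _ I p q). Qed.

(** * Ext^c(S/I, S(-1)) as the colon quotient ((a) : I)/(a) *)

Section ExtQuotient.
Variables (k : fieldType) (V : finType).
Local Notation S := (polyring k V).
Variables (I E A : submodClosed (gpoly k V)) (F : free_resolution (gquot I)).
Variables (a : nat -> 'X_{1..#|V|}) (c : nat).
Local Notation tl := (tailgen a c).

Hypothesis regular : forall j m, (j < c)%N -> tl j.+1 (a j + m)%MM -> tl j.+1 m.
Hypothesis aI : forall j, (j < c)%N -> 'X_[a j] \in I.
Hypothesis degrees_a : \sum_(l < c) mondeg (a l) = ones.
Hypothesis memA : forall p, p \in A <-> mideal (tl 0) p.
Hypothesis colonE : forall e : S, e \in E <-> forall y : S, y \in I -> y * e \in A.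
Hypothesis hcompE : forall b (e : S), e \in E -> hcomp b e \in E.

Definition colon_quot : gmod k V :=
  gquot (M := gsub E) (lpreim (val : submod_type E -> gpoly k V) A).

Lemma annI j (x : gquot I) : (j < c)%N -> 'X_[a j] *: x = 0.
Proof.
move=> /aI aj; have [p ->] := lquot_surj x; rewrite -linearZ /=; apply/lquot_eq0.
have -> : 'X_[a j] *: p = (p : S) * 'X_[a j] by apply: mulrC.
exact: ideal_mull.
Qed.

(** The augmentation F_0 -> S/I is lifted to a homogeneous map F_0 -> S with values [l] on the
    basis. The homomorphism 1 |-> e from S/I to S/A then becomes the cochain [e *: l]. *)
Lemma faug_lifts : exists l : 'cV[S]_(frk F 0),
  (forall t, homogeneous (fdeg t) (l t 0)) /\
  forall w, faug F w = lquot_pi I ((w *m l) 0 0).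
Proof.
have /choice[l lP] : forall t : 'I_(frk F 0), exists p : S,
    homogeneous (fdeg t) p /\ faug F (delta_mx 0 t) = lquot_pi I p.
  by move=> t; have [p] := faug_homogeneous t; exists p.
exists (\col_t l t); split=> [t|w]; first by rewrite mxE; case: (lP t).
rewrite {1}[w]row_sum_delta linear_sum mxE linear_sum; apply: eq_bigr => t _ /=.
rewrite linearZ /= (lP t).2 -linearZ /=; congr (lquot_pi I _).
by rewrite mxE.
Qed.

Section Lift.
Variable l : 'cV[S]_(frk F 0).
Hypothesis lE : forall w, faug F w = lquot_pi I ((w *m l) 0 0).

Lemma faug0 w : faug F w = 0 <-> ((w *m l) 0 0 : S) \in I.
Proof.
by rewrite lE; apply: lquot_eq0. Qed.

Lemma lift_cocycle (e : S) : e \in E -> vmem (tl 0) (fdiff F 0 *m (e *: l)).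
Proof.
move=> /colonE eE s; apply/memA.
rewrite -scalemxAr mxE mulrC; apply: eE.
have /faug0 : faug F (row s (fdiff F 0)) = 0.
  by apply/faug_exact; exists (delta_mx 0 s); rewrite -rowE.
by rewrite -row_mul mxE.
Qed.

(** For [v] over the class of 1, [v *m l] is 1 modulo I, and [e] multiplies I into A; so [e] is
    recovered modulo A from [e *: l]. *)
Lemma lift_mem (e : S) : e \in E -> e \in A <-> vmem (tl 0) (e *: l).
Proof.
move=> /colonE eE; split=> [/memA eA t|eA].
  by rewrite mxE mulrC; apply: mideal_mull => //; apply: tailgen_up.
have [v ve] := faug_surj F (lquot_pi I 1).
have vI : (v *m l) 0 0 - 1 \in I by apply/lquot_piP; rewrite -lE.
have -> : e = (v *m (e *: l)) 0 0 - ((v *m l) 0 0 - 1) * e.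
  by rewrite -scalemxAr mxE mulrBl mul1r mulrC opprB addrC subrK.
apply/memA; apply: midealB; last by apply/memA; apply: eE.
by apply: (@vmem_mul _ _ _ _ _ v) => //; exact: tailgen_up.
Qed.

Lemma lift_surj (h : 'cV[S]_(frk F 0)) : vmem (tl 0) (fdiff F 0 *m h) ->
  exists2 e : S, e \in E & vmem (tl 0) (h - e *: l).
Proof.
move=> hU; have [v ve] := faug_surj F (lquot_pi I 1).
have vI : (v *m l) 0 0 - 1 \in I by apply/lquot_piP; rewrite -lE.
have kerA w : faug F w = 0 -> mideal (tl 0) ((w *m h) 0 0).
  move=> /faug_exact[w' ->]; rewrite -mulmxA.
  by apply: (@vmem_mul _ _ _ _ _ w') => //; exact: tailgen_up.
exists ((v *m h) 0 0).
  apply/colonE => y yI; apply/memA.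
  have : faug F (y *: v) = 0.
    apply/faug0; rewrite -scalemxAl mxE mulrC.
    exact: ideal_mull.
  by move/kerA; rewrite -scalemxAl mxE.
(* In S/I the t-th basis vector and [l t 0 *: v] have the same image, and [h] maps the kernel of the
   augmentation into A. *)
move=> t; have : faug F (delta_mx 0 t - l t 0 *: v) = 0.
  apply/faug0; rewrite mulmxBl -rowE -scalemxAl !mxE.
  rewrite -[X in X - _]mulr1 -mulrBr -opprB mulrN -mulNr; apply: ideal_mull.
  by move: vI; rewrite mxE.
by move/kerA; rewrite mulmxBl -rowE -scalemxAl !mxE mulrC.
Qed.

End Lift.

Lemma vmem_lift_linear j x r (e1 e2 : S) (g1 g2 l : 'cV[S]_r) :
  vmem (tl j) (g1 - e1 *: l) -> vmem (tl j) (g2 - e2 *: l) ->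
  vmem (tl j) (x *: g1 + g2 - (x * e1 + e2) *: l).
Proof.
move=> ge1 ge2; rewrite scalerDl opprD addrACA -scalerA -scalerBr.
apply: vmemD ge2; apply: vmemZ ge1; exact: tailgen_up.
Qed.

Lemma vcomp_lift b (e : S) (l : 'cV[S]_(frk F 0)) :
  (forall t, homogeneous (fdeg t) (l t 0)) ->
  vcomp b (e *: l) = hcomp b e *: l.
Proof.
move=> lhom; apply/colP => t; rewrite !mxE [RHS]mulrC -(hcompM _ _ (lhom t)).
by rewrite addrC mulrC.
Qed.

Local Notation N := (gshift (gpoly k V) (- ones)).

Definition cochain_col i (h : ghom_free F N i) : 'cV[S]_(frk F i) := \col_t h t.
Definition col_cochain i (h : 'cV[S]_(frk F i)) : ghom_free F N i :=
  [ffun t => h t 0].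

Lemma cochain_colK i : cancel (@cochain_col i) (@col_cochain i).
Proof. by move=> h; apply/ffunP => t; rewrite ffunE mxE. Qed.

Lemma col_cochainK i : cancel (@col_cochain i) (@cochain_col i).
Proof. by move=> h; apply/colP => t; rewrite mxE ffunE. Qed.

Lemma cochain_col_linear i x (g h : ghom_free F N i) :
  cochain_col (x *: g + h) = x *: cochain_col g + cochain_col h.
Proof. by apply/colP => t; rewrite !mxE !ffunE. Qed.

Lemma cochain_col_codiff i (h : ghom_free F N i) :
  cochain_col (codiff h) = fdiff F i *m cochain_col h.
Proof.
by apply/colP => s; rewrite !mxE ffunE; apply: eq_bigr => t _; rewrite mxE.
Qed.

(** The last tail has no generators, so the zigzag ends in cochains with values in S itself. *)
Lemma vmem_tl_c r (h : 'cV[S]_r) : vmem (tl c) h <-> h = 0.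
Proof.
split=> [hU|->]; last exact: vmem0.
apply/colP => t; rewrite mxE; apply/mideal_False; apply: mideal_sub (hU t) => m [j].
by case: ltngtP.
Qed.

Lemma cocyclesP i (h : ghom_free F N i) :
  h \in cocycles F N i <-> vmem (tl c) (fdiff F i *m cochain_col h).
Proof.
rewrite vmem_tl_c -cochain_col_codiff.
have -> : (h \in cocycles F N i) = (codiff h == 0) by [].
split=> [/eqP->|E0]; first by apply/colP => t; rewrite !mxE ffunE.
apply/eqP/(can_inj (@cochain_colK _)); rewrite E0.
by apply/colP=> t; rewrite !mxE ffunE.
Qed.

Lemma coboundariesP i (h : ghom_free F N i) :
  h \in coboundaries F N i <-> bdry (tl c) (cochain_col h).
Proof.
case: i h => [|i] h /=.
  rewrite vmem_tl_c; have -> : (h \in sub0 (ghom_free F N 0)) = (h == 0) by [].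
  split=> [/eqP->|E0]; first by apply/colP => t; rewrite !mxE ffunE.
  apply/eqP/(can_inj (@cochain_colK _)); rewrite E0.
  by apply/colP=> t; rewrite !mxE ffunE.
split=> [/asboolP[g _ ->]|[g /vmem_tl_c/subr0_eq hg]].
  by exists (cochain_col g); rewrite cochain_col_codiff subrr; apply: vmem0.
apply/asboolP; exists (col_cochain g) => //.
by apply: (can_inj (@cochain_colK _)); rewrite cochain_col_codiff col_cochainK.
Qed.

Lemma Ext_colon_quot : giso (Ext F N c) colon_quot.
Proof.
have [l [lhom lE]] := faug_lifts.
have annM := annI.
(* The class of [e] corresponds to that of [h] when a zigzag ending in [h] starts at a cochain
   congruent to [e *: l] modulo A. *)
pose R (x : Ext F N c) (y : colon_quot) := exists
    (h : submod_type (cocycles F N c)) (e : submod_type E),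
  [/\ x = lquot_pi _ h, y = lquot_pi _ e & exists2 h0,
      vmem (tl 0) (h0 - (val e : S) *: l)
      & zigzag a c h0 (cochain_col (val h))].
have R0 x y : R x y -> x = 0 <-> y = 0.
  move=> [h [e [-> -> [h0 h0e hz]]]]; rewrite !lquot_eq0.
  have -> : h \in lpreim val (coboundaries F N c) <->
            val h \in coboundaries F N c by [].
  have -> : e \in lpreim val A <-> val e \in A by [].
  rewrite coboundariesP (lift_mem lE (valP e)).
  rewrite -(zigzag_bdry annM regular (leqnn c) hz).
  split=> hU; last by rewrite -[h0](subrK (val e *: l)); apply: vmemD.
  by rewrite -[_ *: _](subKr h0); apply: vmemB.
have Rlin x x1 y1 x2 y2 : R x1 y1 -> R x2 y2 -> R (x *: x1 + x2) (x *: y1 + y2).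
  move=> [h1 [e1 [-> -> [g1 ge1 z1]]]] [h2 [e2 [-> -> [g2 ge2 z2]]]].
  exists (x *: h1 + h2), (x *: e1 + e2).
  split; [by rewrite linearP|by rewrite linearP|].
  exists (x *: g1 + g2); last first.
    by rewrite submod_valP cochain_col_linear; apply: zigzag_linear.
  have -> : val (x *: e1 + e2) = x * (val e1 : S) + val e2 by exact: submod_valP.
  exact: vmem_lift_linear ge1 ge2.
have Rleft e : exists x, R x (lquot_pi _ e).
  have [h0 hz] := zigzag_ex regular (leqnn c) (lift_cocycle lE (valP e)).
  have := zigzag_cocycle regular (leqnn c) (lift_cocycle lE (valP e)) hz.
  rewrite -[h0]col_cochainK => /cocyclesP hZ.
  exists (lquot_pi _ (submodI hZ)), (submodI hZ), e; split=> //.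
  by exists (val e *: l); rewrite ?subrr ?col_cochainK //; apply: vmem0.
have Rright h : exists y, R (lquot_pi _ h) y.
  have /cocyclesP/(zigzag_surj annM (leqnn c))[h0 h0Z hz] := valP h.
  have [e eE h0e] := lift_surj lE h0Z.
  by exists (lquot_pi _ (submodI eE)), h, (submodI eE); split=> //; exists h0.
apply: (giso_rel (R := R)) => //.
- by move=> x; have [p ->] := lquot_surj x.
- by move=> y; have [p ->] := lquot_surj y.
- move=> b _ [h hb ->].
  have /cocyclesP/(zigzag_surj annM (leqnn c))[h0 h0Z hz] := valP h.
  have [e eE h0e] := lift_surj lE h0Z.
  exists (lquot_pi _ (submodI (hcompE b eE))).
    by exists (submodI (hcompE b eE)) => //; apply: hcomp_homogeneous.
  exists h, (submodI (hcompE b eE)); split=> //; exists (vcomp b h0).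
    by rewrite -(vcomp_lift _ _ lhom) -vcompB; apply: vmem_vcomp.
  (* The degree-[b] part of the start goes to the part of degree [b - ones] of the end, which is all
     of [h] because of the twist by [- ones]. *)
  have := zigzag_vcomp b hz; rewrite degrees_a; congr (zigzag _ _ _ _).
  apply/colP => t; rewrite !mxE; apply: hcomp_id.
  by have := hb t; rewrite /= addrCA addrA.
- move=> b _ [e eb ->].
  have eZ := lift_cocycle lE (valP e).
  have [h0 hz] := zigzag_ex regular (leqnn c) eZ.
  have ez : vcomp b (val e *: l) = val e *: l by rewrite vcomp_lift ?hcomp_id.
  have := zigzag_vcomp b hz; rewrite degrees_a ez => hz'.
  have := zigzag_cocycle regular (leqnn c) eZ hz'.
  rewrite -[vcomp _ _ in X in X -> _]col_cochainK => /cocyclesP hZ.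
  exists (lquot_pi _ (submodI hZ)).
    exists (submodI hZ) => // t; rewrite ffunE mxE.
    have := @hcomp_homogeneous _ _ (b - ones + fdeg t) (h0 t 0).
    by rewrite /= addrCA addrA.
  exists (submodI hZ), e; split=> //; exists (val e *: l).
    by rewrite subrr; apply: vmem0.
  by rewrite col_cochainK.
Qed.

End ExtQuotient.

(** * The module ((a) : I)/(a) and its Alexander dual *)

Section MonomialOfDegree.
Variables (k : fieldType) (V : finType).
Local Notation S := (polyring k V).
Implicit Types (b : degree V) (v : V).

Definition mnm_of_deg b : 'X_{1..#|V|} := [multinom `|b (enum_val i)|%N | i < #|V|].

Lemma mnm_of_degK b : (forall v, 0 <= b v) -> mondeg (mnm_of_deg b) = b.
Proof. by move=> b0; apply/ffunP=> v; rewrite ffunE mnmE enum_rankK gez0_abs. Qed.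

Lemma mnm_of_deg_eps b v : (forall u, 0 <= b u) ->
  mnm_of_deg (b + eps v) = (mnm_of_deg b + U_(enum_rank v))%MM.
Proof.
move=> b0; apply: (@mondeg_inj V); rewrite mondegD mondegU !mnm_of_degK // => u.
by rewrite !ffunE addr_ge0.
Qed.

Lemma vars_mnm_of_deg b : vars (mnm_of_deg b) = [set v | b v != 0].
Proof. by apply/setP => v; rewrite !inE mnmE enum_rankK absz_gt0. Qed.

Lemma homogeneous_linear b (c : k) (p q : S) :
  homogeneous b p -> homogeneous b q -> homogeneous b (c%:MP * p + q).
Proof.
move=> pb qb; rewrite -(hcomp_id pb) -(hcomp_id qb) mul_mpolyC -linearP.
exact: hcomp_homogeneous.
Qed.

Lemma homogeneous_var b v (p : S) :
  homogeneous b p -> homogeneous (b + eps v) (var k v * p).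
Proof.
move=> pb; have vE : homogeneous (eps v) (var k v).
  by rewrite -mondegU; apply: homogeneousX.
by rewrite -(hcomp_id pb) -(hcompM _ _ vE) addrC; apply: hcomp_homogeneous.
Qed.

End MonomialOfDegree.

(** * The quotient of squarefree monomial ideals is a squarefree module *)

Section Squarefree.
Variables (k : fieldType) (V : finType).
Local Notation S := (polyring k V).
Variables (E A : submodClosed (gpoly k V)) (QE QA : {set V} -> Prop).
Hypothesis memE : forall p : S, p \in E <-> mideal (fun m => QE (vars m)) p.
Hypothesis memA : forall p : S, p \in A <-> mideal (fun m => QA (vars m)) p.

Local Notation D := (colon_quot E A).
Local Notation piD := (lquot_pi (lpreim (val : submod_type E -> gpoly k V) A)).

Lemma colon_quot_eq (e e' : submod_type E) :
  piD e = piD e' <-> (val e - val e' : S) \in A.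
Proof.
split=> [/lquot_piP|eA]; first by rewrite /in_mem /= /lpreim raddfB.
by apply/lquot_piP; rewrite /in_mem /= /lpreim raddfB.
Qed.

Lemma colon_quot_eq0 (e : submod_type E) : piD e = 0 <-> (val e : S) \in A.
Proof. exact: lquot_eq0. Qed.

Lemma gr_colon_quotP b (x : D) :
  gr b x <-> exists2 e : submod_type E, homogeneous b (val e : S) & x = piD e.
Proof. by []. Qed.

Lemma colon_quot_surj (x : D) : exists e : submod_type E, x = piD e.
Proof. exact: lquot_surj. Qed.

Lemma submod_valM (c : S) (e : submod_type E) : val (c *: e) = c * (val e : S).
Proof. exact: submod_valZ. Qed.

Lemma hcomp_memE b (e : S) : e \in E -> hcomp b e \in E.
Proof. by move=> /memE/mideal_hcomp eE; apply/memE. Qed.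

Lemma submod_val_sum (I : Type) (r : seq I) (f : I -> submod_type E) :
  val (\sum_(i <- r) f i) = \sum_(i <- r) (val (f i) : S).
Proof. exact: (raddf_sum (val : submod_type E -> gpoly k V)). Qed.

Lemma colon_quot_graded : is_graded D.
Proof.
split=> [b|b v x [e eb ->]|x|s f s_uniq fb f0 b bs].
- split.
    exists (0 : submod_type E); last by rewrite linear0.
    exact: homogeneous0.
  move=> c x y [e eb ->] [e' e'b ->]; exists (c%:MP *: e + e' : submod_type E).
    exact: (@homogeneous_linear _ _ _ c _ _ eb e'b).
  by rewrite linearP.
- exists (var k v *: e : submod_type E); last by rewrite linearZ.
  exact: (@homogeneous_var _ _ _ v _ eb).
- have [e ->] := colon_quot_surj x.
  exists (undup (map (@mondeg V) (msupp (val e : S)))).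
  exists (fun b => piD (submodI (hcomp_memE b (valP e)))); split.
    by move=> b; eexists; last by []; apply: hcomp_homogeneous.
  rewrite -linear_sum; congr (lquot_pi _ _); apply: val_inj.
  by rewrite submod_val_sum [LHS]hcomp_sum.
have /choice[g gP] : forall b, exists e : submod_type E,
    homogeneous b (val e : S) /\ f b = piD e.
  by move=> b'; have [e ? ?] := fb b'; exists e.
rewrite (gP b).2; apply/colon_quot_eq0/memA.
have /memA : \sum_(b <- s) (val (g b) : S) \in A.
  rewrite -submod_val_sum; apply/colon_quot_eq0; rewrite linear_sum -[RHS]f0.
  by apply: eq_bigr => b' _; rewrite (gP b').2.
move/(@mideal_hcomp _ _ _ b); rewrite linear_sum (bigD1_seq b) //=.
rewrite (hcomp_id (gP b).1) big1 ?addr0 // => b' b'b.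
apply/mpolyP => m; rewrite mcoeff_hcomp mcoeff0; case: eqP => // mb.
apply/eqP/negPn/negP => /((homogeneousP _ _).1 (gP b').1).
by rewrite mb => E'; rewrite E' eqxx in b'b.
Qed.

Lemma colon_quot_fg : finitely_generated D.
Proof.
have /choice[g gP] : forall B : {set V}, exists e : submod_type E,
    QE B -> val e = 'X_[sqfree_mnm B].
  (* The generators are the squarefree monomials of E; 0 is a dummy for the other sets. *)
  move=> B; have [QB|nQB] := pselect (QE B); last by exists 0.
  have mE : ('X_[sqfree_mnm B] : S) \in E.
    by apply/memE/midealX; rewrite vars_sqfree.
  by exists (submodI mE).
exists [seq piD (g B) | B <- enum {set V}] => x; have [e ->] := colon_quot_surj x.
have -> : e = \sum_(m <- msupp (val e : S))
    (((val e : S)@_m)%:MP * 'X_[m - sqfree_mnm (vars m)]) *: g (vars m).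
  apply: val_inj; rewrite submod_val_sum [LHS]mpolyE big_seq [RHS]big_seq.
  apply: eq_bigr => m; rewrite mcoeff_msupp => me.
  have mQ : QE (vars m) by exact: ((memE _).1 (valP e)) me.
  rewrite submod_valM (gP _ mQ) -mul_mpolyC.
  rewrite -[X in _ * 'X_[X] = _](submK (_ : sqfree_mnm (vars m) <= m)%MM);
    last by rewrite sqfree_mnm_le.
  by rewrite mpolyXD mulrA.
rewrite linear_sum; apply: rpred_sum => m _; rewrite linearZ; apply: rpredZ.
by apply: span_gen; apply: map_f; rewrite mem_enum.
Qed.

(** When [1 <= b v], a monomial of degree [b] already involves v, so multiplying it by x_v changes
    neither its support nor its membership in E and A. *)
Lemma colon_quot_squarefree : squarefree D.
Proof.
split; [exact: colon_quot_graded| |exact: colon_quot_fg|].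
  move=> b _ [e eb ->] e0 v.
  have [/eqP|] := eqVneq (msupp (val e : S)) [::].
    rewrite msupp_eq0 => /eqP ee0; case/eqP: e0; apply/colon_quot_eq0.
    by rewrite ee0; apply/memA; apply: mideal0.
  case E' : (msupp (val e : S)) => [//|m s] _; have <- : mondeg m = b.
    by apply: eb; rewrite E' mem_head.
  by rewrite ffunE.
move=> b v b0 bv; split.
  move=> _ _ /gr_colon_quotP[e eb ->] /gr_colon_quotP[e' e'b ->].
  rewrite -!linearZ => /colon_quot_eq; rewrite !submod_valM -mulrBr => ee'; apply/colon_quot_eq.
  move: ee'.
  move/memA/midealMX => eA; apply/memA => m me.
  have := eA m me; rewrite varsD varsU (setUidPr _) // sub1set inE.
  have mb : mondeg m = b.
    move: me; rewrite mcoeffB; have [->|me _] := eqVneq (val e : S)@_m 0.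
      by rewrite sub0r oppr_eq0 => /((homogeneousP _ _).1 e'b).
    by move: me => /((homogeneousP _ _).1 eb).
  by move: bv; rewrite -mb ffunE.
move=> _ /gr_colon_quotP[e eb ->].
rewrite -[b in b + _]mnm_of_degK // -mondegU -mondegD in eb.
have := homogeneousE eb; set c := _@__ => eE.
have xE : (c *: 'X_[mnm_of_deg b] : S) \in E.
  apply/memE => m; rewrite mcoeffZ mcoeffX.
  have [<-|_] := eqVneq (mnm_of_deg b) m; last first.
    by rewrite mulr0 eqxx.
  rewrite mulr1 => /((memE _).1 (valP e)).
  rewrite varsD varsU (setUidPl _) // sub1set vars_mnm_of_deg inE.
  by apply: contraTneq bv => ->.
exists (piD (submodI xE)).
  exists (submodI xE) => //=; apply/homogeneousP => m; rewrite mcoeffZ mcoeffX.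
  have [<-|_] := eqVneq (mnm_of_deg b) m; last by rewrite mulr0 eqxx.
  by rewrite mnm_of_degK.
rewrite -linearZ; congr (lquot_pi _ _); apply: val_inj.
by rewrite submod_valM [RHS]eE addmC mpolyXD -scalerAr.
Qed.

End Squarefree.

(** * The duality pairing between E/A and the image of L in S/B *)

Section Duality.
Variables (k : fieldType) (V : finType).
Local Notation S := (polyring k V).
Variables (E A L B : submodClosed (gpoly k V)) (QE QA QL QB : {set V} -> Prop).
Hypothesis memE : forall p : S, p \in E <-> mideal (fun m => QE (vars m)) p.
Hypothesis memA : forall p : S, p \in A <-> mideal (fun m => QA (vars m)) p.
Hypothesis memL : forall p : S, p \in L <-> mideal (fun m => QL (vars m)) p.
Hypothesis memB : forall p : S, p \in B <-> mideal (fun m => QB (vars m)) p.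
Hypothesis QEup : forall X Y : {set V}, X \subset Y -> QE X -> QE Y.
Hypothesis QAup : forall X Y : {set V}, X \subset Y -> QA X -> QA Y.
Hypothesis QLup : forall X Y : {set V}, X \subset Y -> QL X -> QL Y.
Hypothesis QBup : forall X Y : {set V}, X \subset Y -> QB X -> QB Y.
Hypothesis dual : forall X, QE X /\ ~ QA X <-> QL (~: X) /\ ~ QB (~: X).

Local Notation D := (colon_quot E A).
Local Notation piD := (lquot_pi (lpreim (val : submod_type E -> gpoly k V) A)).

Definition image_quot : gmod k V :=
  gsub (M := gquot B) (limage (lquot_pi B) L).
Local Notation M := image_quot.

(** The coefficient is set to 0 when the monomial lies in the ideal, which makes it well defined on
    the quotient. *)
Definition coef_mod (Q : {set V} -> Prop) (m : 'X_{1..#|V|}) (p : S) : k :=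
  if `[< Q (vars m) >] then 0 else p@_m.

Lemma coef_mod_linear Q m (c : k) p q :
  coef_mod Q m (c%:MP * p + q) = c * coef_mod Q m p + coef_mod Q m q.
Proof.
rewrite /coef_mod; case: ifP => _; first by rewrite mulr0 addr0.
by rewrite mcoeffD mcoeffCM.
Qed.

Lemma coef_mod_eq (Q : {set V} -> Prop) m p q :
  mideal (fun m => Q (vars m)) (p - q) -> coef_mod Q m p = coef_mod Q m q.
Proof.
move=> pq; rewrite /coef_mod; case: asboolP => // nQ.
by apply/eqP; rewrite -subr_eq0 -mcoeffB; apply/negPn/negP => /pq.
Qed.

Lemma image_quot_surj (x : M) : exists2 p : S, p \in L & val x = lquot_pi B p.
Proof. by have /asboolP[p pL ->] := valP x; exists p. Qed.

Lemma image_quot_eq (x y : M) (p q : S) :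
  val x = lquot_pi B p -> val y = lquot_pi B q -> (p - q : S) \in B -> x = y.
Proof. by move=> xp yq pq; apply: val_inj; rewrite xp yq; apply/lquot_piP. Qed.

Lemma image_quot0 : val (0 : M) = lquot_pi B (0 : S).
Proof. exact: esym (linear0 (lquot_pi B)). Qed.

Lemma image_quot_mon m : QL (vars m) ->
  exists x : M, val x = lquot_pi B ('X_[m] : S).
Proof.
move=> Qm; have xL : lquot_pi B ('X_[m] : S) \in limage (lquot_pi B) L.
  by apply/asboolP; exists 'X_[m] => //; apply/memL/midealX.
by exists (submodI xL).
Qed.

Lemma colon_quot_coef : exists al : 'X_{1..#|V|} -> D -> k,
  forall m e, al m (piD e) = coef_mod QA m (val e : S).
Proof.
have /choice[r rE] := @colon_quot_surj k V E A.
exists (fun m u => coef_mod QA m (val (r u) : S)) => m e.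
by apply: coef_mod_eq; apply/memA; apply/colon_quot_eq; rewrite -rE.
Qed.

Lemma image_quot_coef : exists be : 'X_{1..#|V|} -> M -> k,
  forall m x (p : S), val x = lquot_pi B p -> be m x = coef_mod QB m p.
Proof.
have /choice[r rE] : forall x : M, exists p : S, val x = lquot_pi B p.
  by move=> x; have [p _ ->] := image_quot_surj x; exists p.
exists (fun m x => coef_mod QB m (r x)) => m x p xp.
by apply: coef_mod_eq; apply/memB; apply/lquot_piP; rewrite -rE -xp.
Qed.

(** In complementary 0/1-degrees both modules are spanned by at most one monomial, and [dual] makes
    them vanish together; so the product of the two coefficients is a perfect pairing. *)
Lemma colon_quot_dual : alexander_dual_module M D.
Proof.
split.
  exact: colon_quot_squarefree memE memA.
have [al alE] := colon_quot_coef.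
have [be beE] := image_quot_coef.
have al_lin m (c : k) u u' : al m (c%:MP *: u + u') = c * al m u + al m u'.
  have [e ->] := colon_quot_surj u; have [e' ->] := colon_quot_surj u'.
  by rewrite -linearP !alE submod_valP -coef_mod_linear.
have al0 m : al m (0 : D) = 0.
  have := alE m 0; rewrite (linear0 piD) => ->.
  by rewrite /coef_mod [_@_m]mcoeff0 if_same.
have be_lin m (c : k) x x' : be m (c%:MP *: x + x') = c * be m x + be m x'.
  have [p _ xp] := image_quot_surj x; have [p' _ xp'] := image_quot_surj x'.
  rewrite (beE _ _ _ xp) (beE _ _ _ xp') -coef_mod_linear; apply: beE.
  by rewrite [LHS]submod_valP xp xp' -linearP.
exists (fun b u x => al (mnm_of_deg b) u * be (mnm_of_deg (ones - b)) x) => b b01.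
have b0 v : 0 <= b v by case: (b01 v) => ->.
have b1 v : 0 <= (ones - b) v by rewrite !ffunE; case: (b01 v) => ->.
have supb : vars (mnm_of_deg (ones - b)) = ~: vars (mnm_of_deg b).
  by apply/setP=> v; rewrite !vars_mnm_of_deg !inE !ffunE; case: (b01 v) => ->.
have grD (u : D) : gr b u -> exists e : submod_type E, exists c : k,
    [/\ u = piD e, (val e : S) = c *: 'X_[mnm_of_deg b]
      & c != 0 -> QE (vars (mnm_of_deg b))].
  move=> /gr_colon_quotP[e eb ->]; exists e, (val e : S)@_(mnm_of_deg b); split=> //.
    by apply: homogeneousE; rewrite mnm_of_degK.
  exact: ((memE _).1 (valP e)).
have grM (x : M) : gr (ones - b) x -> exists c : k,
    val x = lquot_pi B (c *: 'X_[mnm_of_deg (ones - b)] : S).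
  case=> p pb xp; exists (p : S)@_(mnm_of_deg (ones - b)); rewrite -homogeneousE //.
  by rewrite mnm_of_degK.
split.
- by move=> u ub c x y _ _; rewrite be_lin mulrDr mulrCA.
- by move=> x xb c u u' _ _; rewrite al_lin mulrDl mulrA.
- move=> u /grD[e [c [-> ec cE]]] u0; apply/colon_quot_eq0.
  have [c0|c0] := eqVneq c 0.
    by rewrite ec c0 scale0r; apply/memA; apply: mideal0.
  have [QAb|nQAb] := pselect (QA (vars (mnm_of_deg b))).
    rewrite ec; apply/memA; rewrite -mul_mpolyC; apply: mideal_mull.
      by move=> m m'; rewrite varsD; apply/QAup/subsetUr.
    exact/midealX.
  have /dual[] : QE (vars (mnm_of_deg b)) /\ ~ QA (vars (mnm_of_deg b)).
    by split => //; apply: cE.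
  rewrite -supb => QLb nQBb; have [x xp] := image_quot_mon QLb.
  have := u0 x; rewrite alE (beE _ _ _ xp) /coef_mod asboolF // asboolF // ec.
  rewrite mcoeffZ !mcoeffX !eqxx !mulr1 => cz; case/eqP: c0; apply: cz.
  exists 'X_[mnm_of_deg (ones - b)] => //; rewrite -{1}[ones - b]mnm_of_degK //.
  exact: homogeneousX.
- move=> f flin.
  have gr0 : gr (ones - b) (0 : M).
    by exists (0 : S); [exact: homogeneous0|exact: image_quot0].
  have f0 : f (0 : M) = 0.
    have := flin 1 0 0 gr0 gr0; rewrite scaler0 addr0 mul1r => /eqP.
    by rewrite eq_sym -subr_eq0 addrK => /eqP.
  have [[QEb nQAb]|nQ] :=
      pselect (QE (vars (mnm_of_deg b)) /\ ~ QA (vars (mnm_of_deg b))).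
    have [] := (dual (vars (mnm_of_deg b))).1 (conj QEb nQAb).
    rewrite -supb => QLb nQBb; have [x0 x0p] := image_quot_mon QLb.
    have x0b : gr (ones - b) x0.
      exists 'X_[mnm_of_deg (ones - b)] => //; rewrite -{1}[ones - b]mnm_of_degK //.
      exact: homogeneousX.
    have eE : (f x0 *: 'X_[mnm_of_deg b] : S) \in E.
      apply/memE; rewrite -mul_mpolyC; apply: mideal_mull; last exact/midealX.
      by move=> m m'; rewrite varsD; apply/QEup/subsetUr.
    exists (piD (submodI eE)).
      exists (submodI eE) => //=; rewrite -[X in homogeneous X _]mnm_of_degK //.
      rewrite -mul_mpolyC -[_ * _]addr0; apply: homogeneous_linear.
        exact: homogeneousX.
      exact: homogeneous0.
    move=> x /grM[c xc]; have fx : f x = c * f x0.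
      have -> : x = c%:MP *: x0 + (0 : M).
        apply: val_inj; rewrite [RHS]submod_valP x0p xc -mul_mpolyC.
        by rewrite linear0 addr0 -linearZ.
      by rewrite flin // f0 addr0.
    rewrite fx alE (beE _ _ _ xc) /coef_mod !asboolF //.
    by rewrite !mcoeffZ !mcoeffX !eqxx !mulr1 mulrC.
  exists 0.
    by exists (0 : submod_type E); [exact: homogeneous0|rewrite linear0].
  (* Here the degree of [x] carries only 0: if its monomial were outside B and [c] nonzero, it would
     occur in [p], hence lie in L, and [dual] would contradict [nQ]. *)
  move=> x /grM[c xc]; have [p pL xp] := image_quot_surj x.
  suff -> : x = (0 : M) by rewrite f0 al0 mul0r.
  apply: (image_quot_eq xc image_quot0); rewrite subr0.
  have [->|c0] := eqVneq c 0.
    by rewrite scale0r; apply/memB; apply: mideal0.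
  apply/memB; rewrite -mul_mpolyC; apply: mideal_mull.
    by move=> m m'; rewrite varsD; apply/QBup/subsetUr.
  apply/midealX; rewrite supb; apply: contrapT => nQBb; apply: nQ; apply/dual.
  split=> //.
  have /lquot_piP/memB : lquot_pi B (c *: 'X_[mnm_of_deg (ones - b)] : S) = lquot_pi B p.
    by rewrite -xc.
  move/(_ (mnm_of_deg (ones - b))); rewrite supb mcoeffB mcoeffZ mcoeffX eqxx mulr1.
  have [->|pm _] := eqVneq p@_(mnm_of_deg (ones - b)) 0.
    by rewrite subr0 => /(_ c0).
  by rewrite -supb; apply: ((memL _).1 pL).
move=> v u x bv /gr_colon_quotP[e eb ->] [p' pb' xp'].
have [p pL xp] := image_quot_surj x.
have b0' w : 0 <= (ones - b - eps v) w.
  rewrite !ffunE; have [->|_] := eqVneq w v; first by rewrite bv.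
  by have := b1 w; rewrite !ffunE subr0.
have mnmb : mnm_of_deg (ones - b) =
    (mnm_of_deg (ones - b - eps v)%R + U_(enum_rank v))%MM.
  by rewrite -mnm_of_deg_eps // subrK.
have xvp : val (var k v *: x) = lquot_pi B (var k v * p : S).
  by rewrite [LHS]submod_valZ xp -linearZ.
rewrite -linearZ !alE submod_valM (beE _ _ _ xp) (beE _ _ _ xvp) opprD addrA.
have coefX m (q : S) : (var k v * q)@_(m + U_(enum_rank v)) = q@_m.
  by rewrite mulrC addmC mcoeffMX.
rewrite mnm_of_deg_eps // mnmb /coef_mod !coefX.
(* Both sides are the same product of coefficients up to the tests in [coef_mod]. When both
   coefficients are nonzero, [dual] and monotonicity make the four tests equivalent. *)
have [->|/((memE _).1 (valP e))eQ] := eqVneq (val e : S)@_(mnm_of_deg b) 0.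
  by rewrite !if_same !mul0r.
have [->|/((memL _).1 pL)pQ] := eqVneq p@_(mnm_of_deg (ones - b - eps v)) 0.
  by rewrite !if_same !mulr0.
set X := vars (mnm_of_deg b + _)%MM.
set Y := vars (mnm_of_deg (ones - b - eps v)) in pQ *.
have XE : vars (mnm_of_deg b) \subset X by rewrite /X varsD subsetUl.
have YE : Y \subset vars (mnm_of_deg (ones - b)) by rewrite mnmb varsD subsetUl.
have YX : Y = ~: X.
  apply/setP=> w; rewrite /X /Y varsD varsU !vars_mnm_of_deg !inE !ffunE.
  have [->|_] := eqVneq w v; first by rewrite bv orbT.
  by rewrite orbF; case: (b01 w) => ->.
rewrite -mnmb; have dualX : ~ QA X <-> ~ QB Y.
  split=> nQ; first by have /dual[] := conj (QEup XE eQ) nQ; rewrite -YX.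
  by have /dual[] : QL (~: X) /\ ~ QB (~: X) by rewrite -YX.
have dualb : ~ QA (vars (mnm_of_deg b)) <->
    ~ QB (vars (mnm_of_deg (ones - b))).
  rewrite supb; split=> nQ; first by have /dual[] := conj eQ nQ.
  by have /dual[] : QL (~: vars (mnm_of_deg b)) /\ ~ QB (~: vars (mnm_of_deg b));
    rewrite // -supb; split; [exact: QLup YE pQ|rewrite supb].
have [QAX|nQAX] := pselect (QA X).
  rewrite (asboolT QAX) mul0r; case: asboolP => nQAb; first by rewrite mul0r.
  by have /dualX[] : ~ QB Y by move/(QBup YE); apply/dualb.
have nQAb : ~ QA (vars (mnm_of_deg b)) by move/(QAup XE).
have /dualX nQBY := nQAX; have /dualb nQBb := nQAb.
by rewrite !asboolF.
Qed.

End Duality.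

(** * Letterplace ideals *)

Section SquarefreeIdeals.
Variables (k : fieldType) (V : finType).

Definition sqideal (Q : {set V} -> Prop) : submodClosed (gpoly k V) :=
  ideal_gen (fun p => exists2 X, p = 'X_[sqfree_mnm X] & Q X).

Lemma upclosed_vars (Q : {set V} -> Prop) :
  (forall X Y : {set V}, X \subset Y -> Q X -> Q Y) -> upclosed (fun m => Q (vars m)).
Proof. by move=> Qup m e; rewrite varsD; apply/Qup/subsetUr. Qed.

Lemma mem_sqideal (Q : {set V} -> Prop) p :
  (forall X Y : {set V}, X \subset Y -> Q X -> Q Y) ->
  p \in sqideal Q <-> mideal (fun m => Q (vars m)) p.
Proof.
move=> Qup; apply: ideal_genP => [|_ [X -> QX]|m Qm].
- exact: upclosed_vars.
- by exists (sqfree_mnm X); rewrite ?vars_sqfree.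
- by exists (sqfree_mnm (vars m)); [rewrite sqfree_mnm_le|exists (vars m)].
Qed.

End SquarefreeIdeals.

Section LetterplaceIdeals.
Variables (k : fieldType) (d : Order.disp_t) (P : finPOrderType d) (n : nat).
Variable J : {set isotone_map P n}.
Local Notation PV := (P * 'I_n)%type.
Local Notation S := (polyring k PV).
Implicit Types (X Y : {set PV}) (f : {ffun P -> 'I_n}).

Definition graph f : {set PV} := [set v | v.2 == f v.1].

Lemma graph_sub f X : graph f \subset X <-> forall p, (p, f p) \in X.
Proof.
split=> [/subsetP fX p|fX]; first by apply: fX; rewrite inE.
by apply/subsetP => -[p i]; rewrite inE /= => /eqP->.
Qed.

Lemma graph_monE (f : isotone_map P n) : graph_mon k f = 'X_[sqfree_mnm (graph (val f))].
Proof.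
rewrite /graph_mon mprodXE; congr 'X_[_]; apply/mnmP => i.
rewrite -[i]enum_valK sqfree_mnmE mnm_sumE; case: (enum_val i) => p j; rewrite inE /=.
rewrite (bigD1 p) //= mnm1E (inj_eq enum_rank_inj) xpair_eqE eqxx eq_sym.
rewrite big1 ?addn0 //.
by move=> q qp; rewrite mnm1E (inj_eq enum_rank_inj) xpair_eqE (negPf qp).
Qed.

(* For a set X of variables, [in_L K], [in_BP], [in_B], [in_dual], [in_rows] and *)
(* [in_colon] say that the monomial x^X lies in L(K), B(P, n), B(J), L(J)^A, (a)   *)
(* and (a) : L(J)^A respectively.                                                  *)
Definition in_L (K : {set isotone_map P n}) X : Prop :=
  exists2 f : isotone_map P n, f \in K & graph (val f) \subset X.
Definition in_BP X : Prop := exists (p q : P) (i j : 'I_n),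
  [/\ (p < q)%O, (j < i)%N, (p, i) \in X & (q, j) \in X].
Definition in_B X : Prop := in_L (~: J) X \/ in_BP X.
Definition in_dual X : Prop := forall f : isotone_map P n,
  f \in J -> exists p, (p, val f p) \in X.
Definition in_rows X : Prop := exists p, forall i, (p, i) \in X.
Definition in_colon X : Prop := forall f,
  graph f \subset ~: X -> exists2 g : isotone_map P n, g \in J & val g = f.

Lemma in_L_up K X Y : X \subset Y -> in_L K X -> in_L K Y.
Proof. by move=> XY [f fK fX]; exists f => //; apply: subset_trans XY. Qed.

Lemma in_BP_up X Y : X \subset Y -> in_BP X -> in_BP Y.
Proof.
by move=> /subsetP XY [p [q [i [j [pq ij pi qj]]]]]; exists p, q, i, j; split; auto.
Qed.

Lemma in_B_up X Y : X \subset Y -> in_B X -> in_B Y.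
Proof. by move=> XY [/(in_L_up XY)|/(in_BP_up XY)]; [left|right]. Qed.

Lemma in_dual_up X Y : X \subset Y -> in_dual X -> in_dual Y.
Proof. by move=> /subsetP XY QX f /QX[p /XY]; exists p. Qed.

Lemma in_rows_up X Y : X \subset Y -> in_rows X -> in_rows Y.
Proof. by move=> /subsetP XY [p pX]; exists p => i; apply/XY. Qed.

Lemma in_colon_up X Y : X \subset Y -> in_colon X -> in_colon Y.
Proof.
by move=> XY QX f fY; apply: QX; apply: subset_trans fY _; rewrite setCS.
Qed.

Lemma not_in_rows X : ~ in_rows X <-> exists f, graph f \subset ~: X.
Proof.
split=> [nA|[f fX] [p pX]]; last first.
  by have := (graph_sub _ _).1 fX p; rewrite inE pX.
have /choice[f fX] : forall p, exists i, (p, i) \notin X.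
  move=> p; apply/not_existsP => pX; apply: nA; exists p => i.
  exact/negPn/negP/pX.
by exists [ffun p => f p]; apply/graph_sub => p; rewrite ffunE inE fX.
Qed.

(** Missing every row means that some map has its graph in the complement of X. All such maps are
    isotone and in J exactly when the complement contains neither a generator of B(P, n) nor the
    graph of an isotone map outside J. *)
Lemma colon_L_dual X : in_colon X /\ ~ in_rows X <-> in_L J (~: X) /\ ~ in_B (~: X).
Proof.
split=> [[QX /not_in_rows[f fX]]|[[f fJ fX] nB]].
  split; first by have [g gJ gf] := QX f fX; exists g; rewrite ?gf.
  case=> [[g]|[p [q [i [j [pq ij pi qj]]]]]].
    rewrite inE => /negP gJ /QX[h hJ /val_inj hg]; by rewrite -hg in gJ.
  (* Changing [f] at the two offending points keeps its graph outside X but destroys isotonicity. *)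
  pose h := [ffun r => if r == p then i else if r == q then j else f r].
  have /QX[g _ gh] : graph h \subset ~: X.
    apply/graph_sub => r; rewrite ffunE.
    have [->//|_] := eqVneq r p; have [->//|_] := eqVneq r q.
    exact: (graph_sub _ _).1.
  have /forallP/(_ p)/forallP/(_ q) := valP g; rewrite (ltW pq) gh !ffunE eqxx /=.
  by rewrite (gt_eqF pq) eqxx leqNgt ij.
split; last by apply/not_in_rows; exists (val f).
move=> h hX; have hiso : isotone h.
  apply/forallP => p; apply/forallP => q; apply/implyP.
  rewrite le_eqVlt => /predU1P[->//|pq]; rewrite leqNgt; apply/negP => hpq.
  apply: nB; right; exists p, q, (h p), (h q).
  by split=> //; exact: (graph_sub _ _).1.
exists (Sub h hiso) => //; apply/negPn/negP => hJ; apply: nB; left.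
by exists (Sub h hiso); rewrite ?inE.
Qed.

Lemma mem_ideal_L K p : p \in ideal_L k K <-> mideal (fun m => in_L K (vars m)) p.
Proof.
apply: ideal_genP => [|_ [f fK ->]|m [f fK fm]].
- by apply: upclosed_vars; apply: in_L_up.
- by exists (sqfree_mnm (graph (val f))); rewrite ?graph_monE // vars_sqfree; exists f.
- exists (sqfree_mnm (graph (val f))); first by rewrite sqfree_mnm_le.
  by exists f => //; rewrite graph_monE.
Qed.

Lemma mem_ideal_BP p : p \in ideal_BP k P n <-> mideal (fun m => in_BP (vars m)) p.
Proof.
apply: ideal_genP => [|_ [p' [q [i [j [pq ij ->]]]]]|m [p' [q [i [j [pq ij pi qj]]]]]].
- by apply: upclosed_vars; apply: in_BP_up.
- exists (U_(enum_rank (p', i)) + U_(enum_rank (q, j)))%MM; first by rewrite mpolyXD.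
  by exists p', q, i, j; rewrite varsD !varsU !inE !eqxx orbT.
- exists (U_(enum_rank (p', i)) + U_(enum_rank (q, j)))%MM; last first.
    by exists p', q, i, j; rewrite mpolyXD.
  (* The two variables are distinct, so their product is squarefree and divides every monomial
     involving both. *)
  have pq' : p' == q = false by rewrite lt_eqF.
  apply/mnm_lepP => t; rewrite mnmDE !mnm1E -[t]enum_valK !(inj_eq enum_rank_inj).
  move: pi qj; rewrite !inE; case: (eqVneq _ (enum_val t)) => [<-|_].
    by rewrite xpair_eqE eq_sym pq' addn0.
  by case: (eqVneq _ (enum_val t)) => [<-|_].
Qed.

Lemma mem_ideal_B p : p \in ideal_B k J <-> mideal (fun m => in_B (vars m)) p.
Proof.
split=> [/asboolP[a [b [/mem_ideal_L aL /mem_ideal_BP bB ->]]]|pQ].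
  apply: midealD.
    by apply: mideal_sub aL => m; left.
  by apply: mideal_sub bB => m; right.
rewrite [p]mpolyE big_seq; apply: rpred_sum => m; rewrite mcoeff_msupp => /pQ Qm.
rewrite -mul_mpolyC; apply: ideal_mull; apply/asboolP; case: Qm => Qm.
  exists 'X_[m], 0; split; [exact/mem_ideal_L/midealX|exact: rpred0|].
  by rewrite addr0.
exists 0, 'X_[m]; split; [exact: rpred0|exact/mem_ideal_BP/midealX|].
by rewrite add0r.
Qed.

(** A common divisor can be shrunk to a single variable, so lying in the dual ideal means meeting
    the graph of every map in J. *)
Lemma mem_Delta p : p \in stanley_reisner_ideal k (Delta k J) <->
  mideal (fun m => in_dual (vars m)) p.
Proof.
rewrite stanley_reisner_Delta; apply: ideal_genP.
- by apply: upclosed_vars; apply: in_dual_up.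
- move=> _ [m -> mJ]; exists m => // f fJ.
  have /mJ[c [c0 cm cf]] : 'X_[sqfree_mnm (graph (val f))] \in ideal_L k J.
    by apply/mem_ideal_L/midealX; rewrite vars_sqfree; exists f.
  have [i ci] : exists i, (0 < c i)%N.
    apply/existsP; apply: contraNT c0; rewrite negb_exists => /forallP c0.
    by apply/eqP/mnmP => i; rewrite mnm0E; apply/eqP; rewrite -leqn0 leqNgt.
  have := leq_trans ci (mnm_lepP cf i); have := leq_trans ci (mnm_lepP cm i).
  rewrite -[i]enum_valK sqfree_mnmE lt0b; case: (enum_val i) => p' j.
  by rewrite inE /= => mi /eqP E; exists p'; rewrite inE -E.
- move=> m mQ; exists m; rewrite ?lepm_refl //; exists m => // m'.
  move=> /mem_ideal_L/midealX[f /mQ[p' mp'] fm']; exists U_(enum_rank (p', val f p'))%MM.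
  have := (graph_sub _ _).1 fm' p'; move: mp'; rewrite !inE => mp' mf.
  split; rewrite ?lep1mP -?lt0n //.
  by apply/negP => /eqP/mnmP/(_ (enum_rank (p', val f p'))); rewrite mnm1E eqxx mnm0E.
Qed.

Definition rowset j : {set PV} := [set v | (enum_rank v.1 : nat) == j].
Definition rowmon j : 'X_{1..#|{: PV}|} := sqfree_mnm (rowset j).

Lemma tailgen_rowmon m : tailgen rowmon #|P| 0 m <-> in_rows (vars m).
Proof.
split=> [[j /= jP]|[p pm]].
  rewrite sqfree_mnm_le => /subsetP jm; exists (enum_val (Ordinal jP)) => i.
  by apply: jm; rewrite inE /= enum_valK.
exists (enum_rank p); rewrite //= sqfree_mnm_le; apply/subsetP => -[q i].
by rewrite inE /= (inj_eq val_inj) (inj_eq enum_rank_inj) => /eqP->.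
Qed.

Lemma rowmon_regular j m :
  tailgen rowmon #|P| j.+1 (rowmon j + m)%MM -> tailgen rowmon #|P| j.+1 m.
Proof.
move=> [l /andP[jl lP]]; rewrite sqfree_mnm_le varsD vars_sqfree => /subsetP lm.
exists l; rewrite ?jl // sqfree_mnm_le; apply/subsetP => v vl.
by have := lm v vl; move: vl; rewrite !inE => /eqP->; rewrite (gtn_eqF jl).
Qed.

Lemma sum_rowmon : \sum_(l < #|P|) mondeg (rowmon l) = ones :> degree PV.
Proof.
apply/ffunP=> v; rewrite sum_ffunE ffunE (bigD1 (enum_rank v.1)) //=.
rewrite ffunE sqfree_mnmE inE eqxx big1 ?addr0 // => l lv.
by rewrite ffunE sqfree_mnmE inE (inj_eq val_inj) eq_sym (negPf lv).
Qed.

Lemma rowmon_mem j : (j < #|P|)%N ->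
  'X_[rowmon j] \in stanley_reisner_ideal k (Delta k J).
Proof.
move=> jP; apply/mem_Delta/midealX => f fJ; exists (enum_val (Ordinal jP)).
by rewrite vars_sqfree inE /= enum_valK.
Qed.

(** If a product misses the graph of [f], so do both factors; the colon factor then forces [f] into
    J, and the factor from L(J)^A must meet its graph. *)
Lemma mem_colon (e : S) : mideal (fun m => in_colon (vars m)) e <->
  forall y : S, y \in stanley_reisner_ideal k (Delta k J) ->
    mideal (fun m => in_rows (vars m)) (y * e).
Proof.
split=> [eE y /mem_Delta yI|eI m me f fm].
  apply: midealM yI eE => m1 m2 QI1 QE2; rewrite varsD.
  have [//|nQA] := pselect (in_rows (vars m1 :|: vars m2)).
  have [f] := (not_in_rows _).1 nQA; rewrite setCU subsetI => /andP[f1 f2].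
  have [g gJ gf] := QE2 f f2; have [p] := QI1 g gJ; rewrite gf.
  by have := (graph_sub _ _).1 f1 p; rewrite inE => /negPf->.
apply: contrapT => nfJ.
(* Conversely, for [f] not in J the complement of its graph meets the graph of every map in J, yet
   its product with [m] still misses the graph of [f] and so contains no row. *)
have /eI/midealMX/(_ m me) : 'X_[sqfree_mnm (~: graph f)] \in
    stanley_reisner_ideal k (Delta k J).
  apply/mem_Delta/midealX => g gJ; rewrite vars_sqfree; apply/not_existsP => gf.
  apply: nfJ; exists g => //; apply/ffunP => p; apply/eqP/negPn/negP => ne.
  by apply: (gf p); rewrite !inE.
rewrite varsD vars_sqfree; apply/not_in_rows; exists f.
by rewrite setCU setCK subsetI subxx.
Qed.

End LetterplaceIdeals.

Theorem proposition4p2 (k : fieldType) (d : Order.disp_t)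
    (P : finPOrderType d) (n : nat) (J : {set isotone_map P n})
    (F : free_resolution (stanley_reisner_ring k (Delta k J))) :
  poset_ideal J ->
  exists D : gmod k (P * 'I_n)%type,
    alexander_dual_module (module_LB k J) D /\ giso (canonical_module F) D.
Proof.
move=> _; pose E := sqideal k (in_colon J); pose A := sqideal k (@in_rows d P n).
have memE (p : polyring k (P * 'I_n)%type) :
    p \in E <-> mideal (fun m => in_colon J (vars m)) p.
  exact/mem_sqideal/in_colon_up.
have memA (p : polyring k (P * 'I_n)%type) :
    p \in A <-> mideal (fun m => in_rows (vars m)) p.
  exact/mem_sqideal/in_rows_up.
exists (colon_quot E A); split.
  apply: (colon_quot_dual memE memA (@mem_ideal_L k d P n J) (@mem_ideal_B k d P n J)).
  - exact: in_colon_up.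
  - exact: in_rows_up.
  - exact: in_L_up.
  - exact: in_B_up.
  - exact: colon_L_dual.
apply: (@Ext_colon_quot _ _ _ E A F (@rowmon d P n)) => //.
- by move=> j m _; apply: rowmon_regular.
- exact: rowmon_mem.
- exact: sum_rowmon.
- move=> p; rewrite memA; split; apply: mideal_sub => m; apply (tailgen_rowmon m).
- move=> e; rewrite memE mem_colon.
  by split=> eA y /eA yA; apply/memA.
- exact: hcomp_memE memE.
Qed.
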